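(* Assume the model $\varphi\sim Q$, $\Pi_j\mid\varphi\sim H^{(j)}_\varphi$ (independently over $j$ given $\varphi$), where the $H^{(j)}_\varphi$ are probability distributions on $\mathcal{P}(\Theta)$ with densities $h_j(\cdot\mid\varphi)$ as described in the context. Let $\Pi_1,\ldots,\Pi_J$ be distributional observations, and let $\bigl(\{H^{(j)}_\varphi:\varphi\in\Phi\}\bigr)_{j=1}^J$ be the corresponding family of marginals. Suppose that (i) $\Phi$ is a compact metric space. Furthermore, suppose $\varphi_0\in\Phi$ satisfies (ii) $Q(D_\varepsilon(\varphi_0))>0$ for every $\varepsilon>0$, and (iii) for each $\varphi\neq\varphi_0$ there is an open set $N_\varphi\ni\varphi$ such that $\inf_{j\ge1}H^{(j)}_{\varphi_0}[Z(N_\varphi,\Pi_j)]>0$. Then for every $\varepsilon>0$ and every open set $C_0\subset\Phi$ containing $D_\varepsilon(\varphi_0)$, the superposterior satisfies $Q^*(C_0\mid\Pi_1,\ldots,\Pi_J)\to1$ as $J\to\infty$, almost surely with respect to the product distribution $H_{\varphi_0}=\bigotimes_{j=1}^\infty H^{(j)}_{\varphi_0}$ of $(\Pi_1,\Pi_2,\ldots)$.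
   Context: $\Theta$ is a Borel space and $\mathcal{P}(\Theta)$ is the space of probability measures on $\Theta$. $(\Phi,\mathcal{B})$ is the parameter space with its Borel $\sigma$-algebra, and $Q$ is a (prior) probability measure on it. $\{p(\cdot\mid\varphi):\varphi\in\Phi\}$ is a family of probability densities on $\Theta$ with respect to a reference (Lebesgue or counting) measure. For each $j\ge1$ and $\varphi\in\Phi$, $H^{(j)}_\varphi$ is the probability distribution on $\mathcal{P}(\Theta)$ having density $h_j(\cdot\mid\varphi)=dH^{(j)}_\varphi/d\kappa$ with respect to a dominating measure $\kappa$ on $\mathcal{P}(\Theta)$, where (assuming integrability) $$h_j(\Pi_j\mid\varphi):=C_j\int_\Theta p(\theta_j\mid\varphi)\,\Pi_j(d\theta_j),$$ and $C_j$ is the normalizing factor such that $h_j$ integrates to 1. For a random variable $Z$, $H^{(j)}_\varphi[Z]$ denotes its expectation with respect to $H^{(j)}_\varphi$. The superposterior is, for $B\in\mathcal{B}$, $$Q^*(B\mid\Pi_1,\ldots,\Pi_J)=\frac{\int_B\prod_{j=1}^J\left[\int_\Theta p(\theta_j\mid\varphi)\Pi_j(d\theta_j)\right]Q(d\varphi)}{\int_\Phi\prod_{j=1}^J\left[\int_\Theta p(\theta_j\mid\varphi)\Pi_j(d\theta_j)\right]Q(d\varphi)}=\frac{\int_B\prod_{j=1}^J h_j(\Pi_j\mid\varphi)\,Q(d\varphi)}{\int_\Phi\prod_{j=1}^J h_j(\Pi_j\mid\varphi)\,Q(d\varphi)}.$$ For probability distributions $\nu_0,\nu$ on the same space, $\operatorname{KL}(\nu_0;\nu)=\int\log\left(\frac{d\nu_0}{d\nu}\right)d\nu_0$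 if $\nu_0$ is absolutely continuous with respect to $\nu$, and $\operatorname{KL}(\nu_0;\nu)=\infty$ otherwise. For $\varphi_0,\varphi\in\Phi$ and $n\ge1$ define $$I_n(\varphi_0;\varphi)=\frac1n\sum_{j=1}^n\operatorname{KL}\bigl(H^{(j)}_{\varphi_0};H^{(j)}_\varphi\bigr).$$ For $\varepsilon>0$ define $D_{n,\varepsilon}(\varphi_0)=\{\varphi\in\Phi : I_n(\varphi_0;\varphi)<\varepsilon\}$ and $D_\varepsilon(\varphi_0)=\bigcap_{n\ge1}D_{n,\varepsilon}(\varphi_0)$. For a Borel set $A\subset\Phi$ define $$Z(A,\Pi_j)=\inf_{\psi\in A}\log\left(\frac{h_j(\Pi_j\mid\varphi_0)}{h_j(\Pi_j\mid\psi)}\right).$$ *)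

(* Defs.v *)
From HB Require Import structures.
From mathcomp Require Import all_boot all_order all_algebra.
From mathcomp Require Import all_classical all_reals all_analysis.

Set Implicit Arguments.
Unset Strict Implicit.
Unset Printing Implicit Defensive.

Import Order.TTheory GRing.Theory Num.Theory.
Import numFieldNormedType.Exports.

Local Open Scope classical_set_scope.
Local Open Scope ring_scope.
Local Open Scope ereal_scope.
Local Open Scope charge_scope.

(* Measurable types are pointed in MathComp-Analysis, metric types are not. *)
#[short(type="pmetricType")]
HB.structure Definition PMetric (K : numDomainType) :=
  { M of Metric K M & Pointed M }.

Definition borel (T : ptopologicalType) : measurableType (@open T).-sigma :=
  g_sigma_algebraType (@open T).

(* Isomorphic, as a measurable space, to a Borel subset of the real line. *)
Definition borel_space (R : realType) (d : measure_display)
    (T : measurableType d) : Prop :=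
  exists f : T -> R, [/\ injective f, measurable_fun setT f &
    forall A : set T, measurable A -> measurable (f @` A)].

Definition coordinate_cylinders (d : measure_display) (T : measurableType d) :
    set (set (nat -> T)) :=
  [set (fun w : nat -> T => w i) @^-1` A | i in setT & A in measurable].

Definition sequence_space (d : measure_display) (T : measurableType d) :
    measurableType (@coordinate_cylinders d T).-sigma :=
  g_sigma_algebraType (@coordinate_cylinders d T).

(* The measurable rectangles below form a pi-system generating the sigma-algebra
   of sequence_space T, hence at most one P satisfies this condition. *)
Definition is_product_probability (R : realType) (d : measure_display)
    (T : measurableType d) (nu : nat -> probability T R)
    (P : probability (sequence_space T) R) : Prop :=
  forall (n : nat) (A : nat -> set T), (forall j, measurable (A j)) ->
    P [set w | forall j, (j < n)%N -> A j (w j)] = \prod_(j < n) nu j (A j).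

Definition KL (R : realType) (d : measure_display) (T : measurableType d)
    (nu0 nu : probability T R) : \bar R :=
  if `[< nu0 `<< nu >]
  then \int[nu0]_x lne (('d (charge_of_finite_measure nu0) '/d nu) x)
  else +oo.

Definition has_density (R : realType) (d : measure_display)
    (T : measurableType d) (kappa : {measure set T -> \bar R})
    (nu : probability T R) (f : T -> \bar R) : Prop :=
  forall A : set T, measurable A -> nu A = \int[kappa]_(x in A) f x.

(* A family of probability densities with respect to mu, jointly measurable in
   the observation and the parameter. *)
Definition density_family (R : realType) (d d' : measure_display)
    (Theta : measurableType d) (Phi : measurableType d')
    (mu : {measure set Theta -> \bar R}) (p : Phi -> Theta -> R) : Prop :=
  [/\ measurable_fun setT (fun x : Phi * Theta => p x.1 x.2),
      forall phi theta, (0 <= p phi theta)%R &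
      forall phi, \int[mu]_theta (p phi theta)%:E = 1].

Definition avg_density (R : realType) (d : measure_display)
    (Theta : measurableType d) (Phi : Type) (p : Phi -> Theta -> R)
    (Pi : pprobability Theta R) (phi : Phi) : \bar R :=
  \int[(Pi : probability Theta R)]_theta (p phi theta)%:E.

(* C j does not depend on phi: the normalising constant is common to the whole
   family, which is what makes it cancel in the superposterior.
   Everywhere below the index j : nat stands for the 1-based index j + 1. *)
Definition obs_density (R : realType) (d : measure_display)
    (Theta : measurableType d) (Phi : Type) (p : Phi -> Theta -> R)
    (C : nat -> R) (j : nat) (Pi : pprobability Theta R) (phi : Phi) : \bar R :=
  (C j)%:E * avg_density p Pi phi.

Definition superposterior (R : realType) (d d' : measure_display)
    (Theta : measurableType d) (Phi : measurableType d')
    (p : Phi -> Theta -> R) (Q : probability Phi R)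
    (J : nat) (Pi : nat -> pprobability Theta R) (B : set Phi) : \bar R :=
  (\int[Q]_(phi in B) \prod_(j < J) avg_density p (Pi j) phi) /
  (\int[Q]_phi \prod_(j < J) avg_density p (Pi j) phi).

Definition avgKL (R : realType) (d : measure_display) (T : measurableType d)
    (Phi : Type) (H : nat -> Phi -> probability T R) (n : nat)
    (phi0 phi : Phi) : \bar R :=
  (n%:R^-1)%:E * \sum_(j < n) KL (H j phi0) (H j phi).

Definition KLball_n (R : realType) (d : measure_display) (T : measurableType d)
    (Phi : Type) (H : nat -> Phi -> probability T R) (n : nat) (eps : R)
    (phi0 : Phi) : set Phi :=
  [set phi | avgKL H n phi0 phi < eps%:E].

Definition KLball (R : realType) (d : measure_display) (T : measurableType d)
    (Phi : Type) (H : nat -> Phi -> probability T R) (eps : R)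
    (phi0 : Phi) : set Phi :=
  \bigcap_(n in [set n | (1 <= n)%N]) KLball_n H n eps phi0.

(* A is uncountable in general, so measurability in Pi is only up to completion;
   the library integral is total and is applied to this function as it stands.
   Division and logarithm are those of \bar R: a / 0 = +oo for a > 0,
   a / +oo = 0, lne 0 = -oo and lne +oo = +oo. *)
Definition inf_logratio (R : realType) (d : measure_display)
    (Theta : measurableType d) (Phi : Type) (p : Phi -> Theta -> R)
    (C : nat -> R) (phi0 : Phi) (j : nat) (A : set Phi)
    (Pi : pprobability Theta R) : \bar R :=
  ereal_inf
    [set lne (obs_density p C j Pi phi0 / obs_density p C j Pi psi) | psi in A].

(* Main.v *)
Require Import Defs.
From HB Require Import structures.
From mathcomp Require Import all_boot all_order all_algebra.
From mathcomp Require Import all_classical all_reals all_analysis.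
From mathcomp Require Import measurable_realfun ess_sup_inf lra.

(* Since the reference measure kappa and the shape of the densities do not
   depend on j, the normalising constants C j all coincide, so the observations
   are independent and identically distributed, and avgKL does not depend on n.

   The strong law is replaced by a one-sided statement: if g has negative mean,
   then almost surely the partial sums of g over an i.i.d. sequence are bounded
   above, without higher moments.  Applied to - W for W of positive mean,
   after truncation and a small shift, it gives almost surely a linear lower
   bound on the partial sums of W.

   For the numerator, the complement of C0 is compact and covered by finitely
   many neighbourhoods N.  The infimum over N of the log-ratio need not be
   measurable, but it is dominated by the Q-essential infimum, which is, and
   which controls the integral over N just as well.  Hence the integral over the
   complement of C0 is at most exp (K - c n) times the likelihood of phi0.
   For the denominator, the same one-sided law at each point of the
   Kullback-Leibler ball of radius c / 2 and Fubini give the lower bound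
   exp (K' - c n / 2) times the likelihood of phi0. *)

Set Implicit Arguments.
Unset Strict Implicit.
Unset Printing Implicit Defensive.

Import Order.TTheory GRing.Theory Num.Theory.
Import numFieldNormedType.Exports.

Local Open Scope classical_set_scope.
Local Open Scope ring_scope.
Local Open Scope ereal_scope.

(** * Partial sums of i.i.d. sequences *)

Definition shift (T : Type) (w : nat -> T) : nat -> T := fun n => w n.+1.

Lemma measurable_coord d (T : measurableType d) n :
  measurable_fun setT (fun w : sequence_space T => (w : nat -> T) n).
Proof.
move=> _ A mA; rewrite setTI; apply: sub_sigma_algebra.
by exists n => //; exists A.
Qed.

Lemma measurable_shift d (T : measurableType d) :
  measurable_fun setT (@shift T : sequence_space T -> sequence_space T).
Proof.
apply: (measurability (@coordinate_cylinders d T : set (set (sequence_space T)))) => //.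
move=> _ [_ [n _ [A mA <-]] <-].
exact: (@measurable_coord d T n.+1).
Qed.

(** * Splitting an i.i.d. sequence into its head and its tail *)

Section iid_sequence.
Context d (T : measurableType d) (R : realType).
Variables (nu : probability T R) (P : probability (sequence_space T) R).
Hypothesis iidP : is_product_probability (fun=> nu) P.

Let hs (w : sequence_space T) : T * sequence_space T :=
  ((w : nat -> T) 0%N, shift w : sequence_space T).

Lemma measurable_head_shift : measurable_fun setT hs.
Proof.
apply: measurable_fun_pair; first exact: measurable_coord.
exact: measurable_shift.
Qed.

(** This is the independence of the first coordinate and the tail, the tail being again distributed
    as [P]. A product measure is determined by rectangles; with the first side [A] fixed, both sides
    are finite measures of the second one, and these agree on a generating pi-system. *)
Lemma head_shift_distribution (X : set (T * sequence_space T)) :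
  measurable X -> (nu \x P) X = P (hs @^-1` X).
Proof.
move=> mX.
pose mhs := isMeasurableFun.Build _ _ _ _ _ measurable_head_shift.
pose hsf : {mfun _ >-> _} := HB.pack hs mhs.
apply: (@product_measure_unique _ _ _ _ _ nu P (pushforward P hsf)) => // A B mA mB.
pose msh := isMeasurableFun.Build _ _ _ _ _ (@measurable_shift d T).
pose shf : {mfun sequence_space T >-> sequence_space T} :=
  HB.pack (@shift T : sequence_space T -> sequence_space T) msh.
have mA0 : measurable ((fun w : sequence_space T => (w : nat -> T) 0%N) @^-1` A).
  by rewrite -[_ @^-1` _]setTI; exact: measurable_coord.
have nuA : nu A \is a fin_num by exact: fin_num_measure.
have nuA0 : (0 <= fine (nu A))%R by apply: fine_ge0.
(* [m1 B] is the probability that the head lies in [A] and the tail in [B]; [m2 B] is the product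
   [nu A * P B]. *)
pose m1 := pushforward (mrestr P mA0) shf.
pose m2 := mscale (NngNum nuA0) P.
have m2E E : m2 E = nu A * P E by rewrite -[in RHS](fineK nuA).
suff : m1 B = m2 B.
  rewrite m2E => <-; rewrite /m1 /pushforward /mrestr /=.
  by congr (P _); apply/seteqP; split => w /= [].
(* [G] is the pi-system of rectangles constraining finitely many coordinates. *)
pose G : set (set (sequence_space T)) :=
  [set E | exists n (D : nat -> set T), (forall j, measurable (D j)) /\
     E = [set w | forall j, (j < n)%N -> D j ((w : nat -> T) j)]].
have GT : G setT.
  by exists 0%N, (fun=> setT); split => //; apply/seteqP; split.
have mG (E : set (sequence_space T)) : G E -> measurable E.
  move=> [n [D [mD ->]]].
  rewrite (_ : [set _ | _] = \bigcap_(j < n)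
      ((fun w : sequence_space T => (w : nat -> T) j) @^-1` D j)).
    apply: bigcap_measurableType => //= k _; rewrite -[_ @^-1` _]setTI.
    exact: measurable_coord.
  by apply/seteqP; split => w.
apply: (measure_unique G (fun=> setT)) => //.
- apply/seteqP; split.
    apply: smallest_sub; first exact: smallest_sigma_algebra.
    move=> _ [i _ [D mD <-]]; apply: sub_sigma_algebra.
    exists i.+1, (fun j => if j == i then D else setT).
    split; first by move=> j; case: ifP.
    apply/seteqP; split => w /=.
      by move=> Dw j ji; case: eqP => // ->.
    by move=> /(_ i (ltnSn _)); rewrite eqxx.
  by apply: smallest_sub => //; exact: sigma_algebra_measurable.
- move=> _ _ [n1 [D1 [mD1 ->]]] [n2 [D2 [mD2 ->]]].
  exists (maxn n1 n2), (fun j => (if (j < n1)%N then D1 j else setT) `&`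
                                 (if (j < n2)%N then D2 j else setT)); split.
    by move=> j; apply: measurableI; case: ifP.
  apply/seteqP; split => w /=.
    by move=> [w1 w2] j _; split; case: ifP => // ?; [exact: w1|exact: w2].
  move=> w12; split => j jn.
    by have /(_ _)[|+ _] := w12 j; rewrite ?leq_max jn.
  by have /(_ _)[|_] := w12 j; rewrite ?leq_max jn ?orbT.
- by apply/seteqP; split => // x _; exists 0%N.
- move=> _ [n [D [mD ->]]]; rewrite -[RHS]/(m2 _) m2E /m1 /pushforward /mrestr /=.
  (* Putting [A] in front of the sides [D] gives a rectangle of length [n.+1], whose probability is
     known. *)
  pose D' j := if j is j'.+1 then D j' else A.
  have mD' j : measurable (D' j) by case: j.
  have := iidP n.+1 mD'; rewrite big_ord_recl /= (iidP n mD) => <-.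
  congr (P _); apply/seteqP; split => w /=.
    by move=> [wD wA] [|j]//; exact: wD.
  by move=> wD; split; [move=> j jn; exact: (wD j.+1)|exact: (wD 0%N)].
- move=> _; apply: (@le_lt_trans _ _ 1); last exact: ltry.
  apply: probability_le1; apply: measurableI => //.
  by rewrite -[X in measurable X]setTI; exact: measurable_shift.
Qed.

Lemma integral_head_shift (f : T * sequence_space T -> \bar R) :
  measurable_fun setT f -> (forall x, 0 <= f x) ->
  \int[P]_w f (hs w) = \int[nu \x P]_z f z.
Proof.
move=> mf f0.
pose mhs := isMeasurableFun.Build _ _ _ _ _ measurable_head_shift.
pose hsf : {mfun _ >-> _} := HB.pack hs mhs.
rewrite (@eq_measure_integral _ _ _ _ (pushforward P hsf)); last first.
  by move=> A mA _; exact: head_shift_distribution.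
by rewrite (ge0_integral_pushforward measurable_head_shift).
Qed.

(** * Running maxima of a random walk with negative drift *)

Section partial_sums.
Variable g : T -> R.
Hypothesis mg : measurable_fun setT g.

Let gp x : R := Num.max 0%R (g x).
Let gn x : R := Num.max 0%R (- g x)%R.

Let mgp : measurable_fun setT gp.
Proof. exact: measurable_maxr. Qed.

Let mgn : measurable_fun setT gn.
Proof. by apply: measurable_maxr => //; exact: measurableT_comp. Qed.

(** The maximum of the partial sums of lengths 0 to [n]. The recursion peels off the first
    coordinate, so that it matches the head and tail decomposition. *)
Fixpoint running_max (n : nat) (w : sequence_space T) : R :=
  if n is n'.+1 then Num.max 0%R (g ((w : nat -> T) 0%N) + running_max n' (shift w))%R
  else 0%R.

Local Notation M := running_max.

Lemma running_max_ge0 n w : (0 <= M n w)%R.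
Proof. by case: n => //= n; rewrite le_max lexx. Qed.

Lemma running_max_le n m w : (n <= m)%N -> (M n w <= M m w)%R.
Proof.
elim: n m w => [|n ih] [|m] w //= nm; first by rewrite le_max lexx.
by rewrite ge_max !le_max lexx/= lerD2l ih ?orbT.
Qed.

Lemma partial_sum_le_running_max n (w : sequence_space T) :
  (\sum_(i < n) g ((w : nat -> T) i) <= M n w)%R.
Proof.
elim: n w => [|n ih] w; first by rewrite big_ord0.
by rewrite big_ord_recl /= le_max lerD2l; apply/orP; right; exact: ih (shift w).
Qed.

Lemma measurable_running_max n : measurable_fun setT (M n).
Proof.
elim: n => [|n ih] /=; first exact: measurable_cst.
apply: measurable_maxr => //; apply: measurable_funD.
  exact: (measurableT_comp mg (@measurable_coord _ T 0%N)).
exact: (measurableT_comp ih (@measurable_shift d T)).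
Qed.

(** The event that the partial sums are unbounded above, written with countably many levels. *)
Let B : set (sequence_space T) := \bigcap_k \bigcup_n [set w | (k%:R < M n w)%R].

Let mB : measurable B.
Proof.
apply: bigcap_measurableType => // k _; apply: bigcup_measurable => n _.
rewrite -[X in measurable X]setTI; under eq_set do rewrite -lte_fin.
apply: measurable_lte => //.
by apply/measurable_EFinP; exact: measurable_running_max.
Qed.

(** Dropping the first coordinate changes the later partial sums by the fixed real [g (w 0)], which
    does not affect unboundedness. In both directions the level [k] is raised by a bound for this
    change, rounded up to an integer. *)
Let B_shift w : \1_B w = \1_B (shift w : sequence_space T) :> R.
Proof.
rewrite !indicE; congr (_%:R); congr nat_of_bool.
apply/idP/idP; rewrite !inE => Bw k _.
- have [[|n] _ /=] := Bw (Num.truncn (k%:R + gp ((w : nat -> T) 0%N))%R).+1 I.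
    by rewrite ltNge ler0n.
  rewrite lt_max ltNge ler0n /= => h; exists n => //=.
  have : (k%:R + gp ((w : nat -> T) 0%N) < (Num.truncn (k%:R + gp ((w : nat -> T) 0%N))%R).+1%:R)%R.
    exact: truncnS_gt.
  have : (g ((w : nat -> T) 0%N) <= gp ((w : nat -> T) 0%N))%R by rewrite le_max lexx orbT.
  by move: h; lra.
- have [n _ /= h] := Bw (Num.truncn (k%:R + gn ((w : nat -> T) 0%N))%R).+1 I.
  exists n.+1 => //=; rewrite lt_max; apply/orP; right.
  have : (k%:R + gn ((w : nat -> T) 0%N) < (Num.truncn (k%:R + gn ((w : nat -> T) 0%N))%R).+1%:R)%R.
    exact: truncnS_gt.
  have : (- g ((w : nat -> T) 0%N) <= gn ((w : nat -> T) 0%N))%R by rewrite le_max lexx orbT.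
  by move: h; lra.
Qed.

(** Negative mean, stated so that the negative part may have infinite integral; the positive part
    then has a finite one. *)
Hypothesis g_drift : \int[nu]_x (gp x)%:E < \int[nu]_x (gn x)%:E.

Let mfst (f : T -> R) : measurable_fun setT f ->
  measurable_fun setT (fun z : T * sequence_space T => f z.1).
Proof. by move=> mf; exact: measurableT_comp. Qed.

Let msnd (f : sequence_space T -> R) : measurable_fun setT f ->
  measurable_fun setT (fun z : T * sequence_space T => f z.2).
Proof. by move=> mf; exact: measurableT_comp. Qed.

Let integral_product (f : T -> R) (h : sequence_space T -> R) :
  measurable_fun setT f -> measurable_fun setT h ->
  (forall x, 0 <= f x)%R -> (forall w, 0 <= h w)%R ->
  \int[nu \x P]_z (f z.1 * h z.2)%:E = (\int[nu]_x (f x)%:E) * (\int[P]_w (h w)%:E).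
Proof.
move=> mf mh f0 h0; rewrite fubini_tonelli1//=; last 2 first.
- by apply/measurable_EFinP; apply: measurable_funM; [exact: mfst|exact: msnd].
- by move=> z; rewrite lee_fin mulr_ge0.
rewrite -ge0_integralZr//; last 3 first.
- exact/measurable_EFinP.
- by move=> x _; rewrite lee_fin.
- by apply: integral_ge0 => w _; rewrite lee_fin.
apply: eq_integral => x _; rewrite /fubini_F /=.
under eq_integral do rewrite EFinM.
rewrite ge0_integralZl_EFin//; first by move=> w _; rewrite lee_fin.
exact/measurable_EFinP.
Qed.

Let integral_fst (f : T -> R) : measurable_fun setT f -> (forall x, 0 <= f x)%R ->
  \int[nu \x P]_z (f z.1)%:E = \int[nu]_x (f x)%:E.
Proof.
move=> mf f0.
transitivity (\int[nu \x P]_z (f z.1 * cst 1%R z.2)%:E).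
  by apply: eq_integral => z _; rewrite mulr1.
rewrite integral_product// [X in _ * X](_ : _ = 1) ?mule1//.
by apply: etrans (integral_cst P measurableT 1) _; rewrite mul1e; exact: probability_setT.
Qed.

Let integral_snd (h : sequence_space T -> R) :
  measurable_fun setT h -> (forall w, 0 <= h w)%R ->
  \int[nu \x P]_z (h z.2)%:E = \int[P]_w (h w)%:E.
Proof.
move=> mh h0.
transitivity (\int[nu \x P]_z (cst 1%R z.1 * h z.2)%:E).
  by apply: eq_integral => z _; rewrite mul1r.
rewrite integral_product// [X in X * _](_ : _ = 1) ?mul1e//.
by apply: etrans (integral_cst nu measurableT 1) _; rewrite mul1e; exact: probability_setT.
Qed.

Let gp0 x : (0 <= gp x)%R. Proof. by rewrite le_max lexx. Qed.
Let gn0 x : (0 <= gn x)%R. Proof. by rewrite le_max lexx. Qed.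
Let gp_fin : \int[nu]_x (gp x)%:E < +oo.
Proof. by apply: lt_le_trans g_drift _; exact: leey. Qed.

Let one0 (w : sequence_space T) : (0 <= (\1_B w : R))%R.
Proof. by rewrite indicE ler0n. Qed.
Let mone : measurable_fun setT (\1_B : sequence_space T -> R).
Proof. exact: measurable_indic. Qed.
Let mM := measurable_running_max.
Let M0 := running_max_ge0.

(** Induction on [n] from [max (0, g + m) <= g+ + m] for [m >= 0]. Finiteness allows the
    cancellation of the terms in [M] below. *)
Lemma integral_running_max_fin n : \int[P]_w (M n w)%:E < +oo.
Proof.
elim: n => [|n ih] /=; first by rewrite integral0.
pose f (z : T * sequence_space T) := (Num.max 0 (g z.1 + M n z.2))%:E%R.
have mf : measurable_fun setT f.
  apply/measurable_EFinP; apply: measurable_maxr => //.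
  by apply: measurable_funD; [exact: mfst|exact: msnd].
have := integral_head_shift mf; rewrite /f /= => -> //; last first.
  by move=> z; rewrite lee_fin le_max lexx.
apply: (@le_lt_trans _ _ (\int[nu \x P]_z ((gp z.1)%:E + (M n z.2)%:E))).
  apply: ge0_le_integral => //.
  - by move=> z _; rewrite lee_fin le_max lexx.
  - by apply: emeasurable_funD; apply/measurable_EFinP; [exact: mfst|exact: msnd].
  - move=> z _; rewrite -EFinD lee_fin ge_max addr_ge0//= lerD2r.
    by rewrite le_max lexx orbT.
rewrite ge0_integralD//.
- by rewrite integral_fst// integral_snd//; exact: lte_add_pinfty.
- by move=> z _; rewrite lee_fin.
- by apply/measurable_EFinP; exact: mfst.
- by move=> z _; rewrite lee_fin.
- by apply/measurable_EFinP; exact: msnd.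
Qed.

Let P_B : \int[P]_w (\1_B w)%:E = P B.
Proof. by rewrite integral_indic// setIT. Qed.

(* With m = M n (shift w), the identity
   max (0, g + m) + min (g-, m) = m + g+
   is integrated over the shift-invariant event B that the partial sums are
   unbounded; M n.+1 dominates M n, so the terms in M cancel. *)
Let min_bound n :
  \int[nu \x P]_z (Num.min (gn z.1) (M n z.2) * \1_B z.2)%:E
    <= (\int[nu]_x (gp x)%:E) * P B.
Proof.
pose a k := \int[P]_w (M k w * \1_B w)%:E.
have a_fin k : a k \is a fin_num.
  rewrite ge0_fin_numE; last first.
    by apply: integral_ge0 => w _; rewrite lee_fin mulr_ge0.
  apply: le_lt_trans (integral_running_max_fin k); apply: ge0_le_integral => //.
  - by move=> w _; rewrite lee_fin mulr_ge0.
  - by apply/measurable_EFinP; exact: measurable_funM.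
  - exact/measurable_EFinP.
  - move=> w _; rewrite lee_fin ler_piMr// indicE lern1.
have ale : a n <= a n.+1.
  apply: ge0_le_integral => //.
  - by move=> w _; rewrite lee_fin mulr_ge0.
  - by apply/measurable_EFinP; exact: measurable_funM.
  - by apply/measurable_EFinP; exact: measurable_funM.
  - by move=> w _; rewrite lee_fin ler_wpM2r// running_max_le.
pose f (z : T * sequence_space T) := (Num.max 0 (g z.1 + M n z.2) * \1_B z.2)%:E%R.
have mf : measurable_fun setT f.
  apply/measurable_EFinP; apply: measurable_funM; last exact: msnd.
  apply: measurable_maxr => //.
  by apply: measurable_funD; [exact: mfst|exact: msnd].
have f0 z : 0 <= f z by rewrite lee_fin mulr_ge0// le_max lexx.
have aS : a n.+1 = \int[nu \x P]_z f z.
  rewrite -integral_head_shift//; apply: eq_integral => w _.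
  by rewrite /f /= B_shift.
have m0 (z : T * sequence_space T) : (0 <= Num.min (gn z.1) (M n z.2) * \1_B z.2)%R.
  by rewrite mulr_ge0// le_min gn0 M0.
have mmin : measurable_fun setT (fun z : T * sequence_space T =>
    (Num.min (gn z.1) (M n z.2) * \1_B z.2)%:E).
  apply/measurable_EFinP; apply: measurable_funM; last exact: msnd.
  by apply: measurable_minr; [exact: mfst|exact: msnd].
rewrite -(@leeD2lE _ (a n.+1))//.
apply: (@le_trans _ _ (a n + (\int[nu]_x (gp x)%:E) * P B)); last first.
  exact: leeD2r.
rewrite aS -ge0_integralD//; last by move=> z _; rewrite lee_fin m0.
have -> : a n = \int[nu \x P]_z (M n z.2 * \1_B z.2)%:E.
  rewrite (@integral_snd (fun w => M n w * \1_B w)%R)//; first exact: measurable_funM.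
  by move=> w; rewrite mulr_ge0.
rewrite -P_B -integral_product// -ge0_integralD//; last 4 first.
- by move=> z _; rewrite lee_fin mulr_ge0.
- by apply/measurable_EFinP; exact: (msnd (measurable_funM (mM n) mone)).
- by move=> z _; rewrite lee_fin mulr_ge0.
- by apply/measurable_EFinP; apply: measurable_funM; [exact: mfst|exact: msnd].
rewrite le_eqVlt; apply/orP; left; apply/eqP; apply: eq_integral => z _.
rewrite /f -!EFinD -!mulrDl /gp /gn; congr ((_ * _)%:E).
have := M0 n z.2; move: (M n z.2) (g z.1) => m y m0'.
by rewrite /Num.max /Num.min; do ! case: ifPn; rewrite -?leNgt; lra.
Qed.

(** As [n] grows, [min (g-, M n)] increases to [g-] on [B]. In the limit [min_bound] says that the
    integral of [g-] times [P B] is at most the integral of [g+] times [P B], which contradicts the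
    drift unless [P B = 0]. *)
Lemma partial_sums_bounded :
  {ae P, forall w : nat -> T, exists K : R, forall n, (\sum_(i < n) g (w i) <= K)%R}.
Proof.
exists B; split => //; last first.
  move=> w /= nK k _; apply: contrapT => nB; apply: nK; exists k%:R => n.
  apply: le_trans (partial_sum_le_running_max n w) _.
  by rewrite leNgt; apply/negP => h; apply: nB; exists n.
pose f_ n (z : T * sequence_space T) := (Num.min (gn z.1) (M n z.2) * \1_B z.2)%:E.
have f_0 n z : 0 <= f_ n z.
  by rewrite lee_fin mulr_ge0// le_min gn0 M0.
have mf_ n : measurable_fun setT (f_ n).
  apply/measurable_EFinP; apply: measurable_funM; last exact: msnd.
  by apply: measurable_minr; [exact: mfst|exact: msnd].
have nd z : nondecreasing_seq (f_ ^~ z).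
  move=> n m nm; rewrite lee_fin ler_wpM2r// le_min ge_min lexx /=.
  by rewrite ge_min running_max_le ?orbT.
have lim_f z : limn (f_ ^~ z) = (gn z.1 * \1_B z.2)%:E.
  apply/cvg_lim => //.
  have [Bz|nBz] := pselect (B z.2); last first.
    rewrite /f_ indicE memNset// mulr0.
    by under eq_fun do rewrite mulr0; exact: cvg_cst.
  (* On [B] the running maximum eventually exceeds [gn z.1], and from then on the minimum is
     constant. *)
  have [k _ kM] := Bz (Num.truncn (gn z.1)).+1 I.
  apply: cvg_near_cst; exists k => // n /= kn.
  rewrite /f_; congr ((_ * _)%:E); apply/min_idPl.
  apply: ltW; apply: lt_trans (truncnS_gt _) _.
  exact: lt_le_trans kM (running_max_le _ kn).
have : (\int[nu]_x (gn x)%:E) * P B <= (\int[nu]_x (gp x)%:E) * P B.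
  rewrite -[in leLHS]P_B -integral_product//.
  under eq_integral do rewrite -lim_f.
  rewrite monotone_convergence//.
  apply: lime_le; last by near=> n; exact: min_bound.
  apply: ereal_nondecreasing_is_cvgn => n m nm.
  by apply: ge0_le_integral => // z _; exact: nd.
have PBfin : P B \is a fin_num by exact: fin_num_measure.
have [//|PB0] := eqVneq (P B) 0.
have PBgt : 0 < P B by rewrite lt_neqAle eq_sym PB0 measure_ge0.
by rewrite leNgt lte_pmul2r// g_drift.
Unshelve. all: by end_near. Qed.

End partial_sums.
End iid_sequence.

(** * Almost sure statements and linear lower bounds for i.i.d. sums *)

Lemma ae_imp d (T : measurableType d) (R : realType)
    (mu : {measure set T -> \bar R}) (A C : T -> Prop) :
  (forall x, A x -> C x) ->
  {ae mu, forall x, A x} -> {ae mu, forall x, C x}.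
Proof. by move=> AC; apply: filterS. Qed.

Lemma ae_imp2 d (T : measurableType d) (R : realType)
    (mu : {measure set T -> \bar R}) (A B C : T -> Prop) :
  (forall x, A x -> B x -> C x) ->
  {ae mu, forall x, A x} -> {ae mu, forall x, B x} -> {ae mu, forall x, C x}.
Proof. by move=> ABC; apply: filterS2. Qed.

Lemma integral_cst_probability d (T : measurableType d) (R : realType)
    (P : probability T R) (r : \bar R) : \int[P]_x r = r.
Proof.
apply: etrans (integral_cst P measurableT r) _.
by rewrite [X in _ * X](_ : _ = 1) ?mule1//; exact: probability_setT.
Qed.

Section iid_sequence_bounds.
Context d (T : measurableType d) (R : realType).
Variables (nu : probability T R) (P : probability (sequence_space T) R).
Hypothesis iidP : is_product_probability (fun=> nu) P.

(** For each [j] the exceptional set pulls back to a rectangle with one null side, and there are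
    countably many [j]. *)
Lemma ae_all_coordinates (E : T -> Prop) :
  {ae nu, forall x, E x} -> {ae P, forall w : nat -> T, forall j, E (w j)}.
Proof.
move=> [N [mN N0 NE]]; apply/ae_foralln => j.
exists ((fun w : sequence_space T => (w : nat -> T) j) @^-1` N); split.
- by rewrite -[_ @^-1` _]setTI; exact: measurable_coord.
- pose A i := if i == j then N else setT.
  have mA i : measurable (A i) by rewrite /A; case: ifP.
  rewrite (_ : _ @^-1` _ = [set w : sequence_space T |
      forall i, (i < j.+1)%N -> A i ((w : nat -> T) i)]).
    apply: etrans (iidP j.+1 mA) _; rewrite (bigD1 ord_max)//= {1}/A eqxx.
    by rewrite [X in X * _](_ : _ = 0) ?mul0e.
  apply/seteqP; split => w /=.
    by move=> Nw i _; rewrite /A; case: eqP => // ->.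
  by move=> /(_ j (ltnSn _)); rewrite /A eqxx.
- by move=> w nE; apply: NE => h; exact: nE.
Qed.

(* g is c minus a truncation of W from above: the truncation level is chosen by
   monotone convergence so that the mean stays positive. *)
Lemma truncation_positive_mean (W : T -> \bar R) :
  measurable_fun setT W -> 0 < \int[nu]_x W x ->
  exists (c : R) (g : T -> R), [/\ (0 < c)%R, measurable_fun setT g,
    \int[nu]_x (Num.max 0%R (g x))%:E < \int[nu]_x (Num.max 0%R (- g x)%R)%:E &
    {ae nu, forall x, (c - g x)%:E <= W x}].
Proof.
move=> mW; rewrite integralE => W0.
set a := \int[nu]_x W^\- x in W0 *.
have a0 : 0 <= a by apply: integral_ge0.
(* An infinite negative part would make the integral of [W] equal to [-oo], even against an infinite
   positive part. *)
have afin : a \is a fin_num.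
  rewrite ge0_fin_numE// ltey; apply/eqP => ay; move: W0.
  by rewrite ay /= addeNy.
have {W0} aW : a < \int[nu]_x W^\+ x by rewrite -sube_gt0.
pose u_ n x := mine (W^\+ x) (n%:R%:E).
have u_0 n x : 0 <= u_ n x by rewrite le_min funepos_ge0 lee_fin ler0n.
have mu_ n : measurable_fun setT (u_ n).
  by apply: measurable_mine => //; exact: measurable_funepos.
have [n an] : exists n, a < \int[nu]_x u_ n x.
  apply: contrapT => /forallNP h; move: aW; apply/negP; rewrite -leNgt.
  have lim_u x : limn (u_ ^~ x) = W^\+ x.
    apply/cvg_lim => //.
    have := funepos_ge0 W x; rewrite /u_; case: (W^\+ x) => [r|_|//].
      rewrite lee_fin => r0; apply: cvg_near_cst.
      exists (Num.truncn r).+1 => // k /= rk.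
      apply/min_idPl; rewrite lee_fin; apply: ltW.
      by apply: lt_le_trans (truncnS_gt _) _; rewrite ler_nat.
    under eq_fun do rewrite min_r ?leey//.
    by apply/cvgeryP; exact: cvgr_idn.
  under eq_integral do rewrite -lim_u.
  rewrite monotone_convergence//.
    apply: lime_le.
      apply: ereal_nondecreasing_is_cvgn => k m km.
      apply: ge0_le_integral => // x _.
      by rewrite /u_ le_min ge_min lexx /= ge_min lee_fin ler_nat km orbT.
    by near=> k; rewrite leNgt; apply/negP; exact: h.
  move=> x _ k m km.
  by rewrite /u_ le_min ge_min lexx /= ge_min lee_fin ler_nat km orbT.
pose u x := fine (u_ n x); pose v x := fine (W^\- x).
have mu : measurable_fun setT u by exact: measurableT_comp.
have mv : measurable_fun setT v.
  by apply: measurableT_comp => //; exact: measurable_funeneg.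
have uE x : (u x)%:E = u_ n x.
  rewrite fineK// ge0_fin_numE//; apply: (@le_lt_trans _ _ n%:R%:E).
    by rewrite ge_min lexx orbT.
  exact: ltry.
have u0 x : (0 <= u x)%R by rewrite -lee_fin uE.
have v0 x : (0 <= v x)%R by rewrite fine_ge0.
(* [fine] sends [+oo] to 0, so [v] agrees with the negative part only where the latter is finite; it
   is integrable, hence finite almost everywhere. *)
have vE : {ae nu, forall x, (v x)%:E = W^\- x}.
  have iW : nu.-integrable setT W^\-.
    apply/integrableP; split; first exact: measurable_funeneg.
    under eq_integral do rewrite gee0_abs//.
    by rewrite -ge0_fin_numE.
  have := integrable_ae measurableT iW; apply: filterS => x /= fx.
  by rewrite /v fineK//; exact: fx I.
have Vint : \int[nu]_x (v x)%:E = a.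
  apply: ge0_ae_eq_integral => //.
  - exact/measurable_EFinP.
  - exact: measurable_funeneg.
  - by move=> x _; rewrite lee_fin.
  - by move: vE; apply: filterS => x h _; exact: h.
have Uint : \int[nu]_x (u x)%:E = \int[nu]_x u_ n x.
  by apply: eq_integral => x _; rewrite uE.
have bfin : \int[nu]_x u_ n x \is a fin_num.
  rewrite ge0_fin_numE ?integral_ge0//.
  apply: (@le_lt_trans _ _ (\int[nu]_x (cst n%:R%:E x))).
    by apply: ge0_le_integral => // x _; rewrite ge_min lexx orbT.
  by rewrite integral_cst_probability ltry.
pose b := fine (\int[nu]_x u_ n x).
(* The truncated function [u - v] has mean [b - a = 2c], so that [c - (u - v)] has mean [-c]. *)
pose c := ((b - fine a) / 2)%R.
have c0 : (0 < c)%R by rewrite divr_gt0// subr_gt0 -lte_fin !fineK.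
exists c, (fun x => c - (u x - v x))%R; split => //.
- apply: measurable_funB => //; exact: measurable_funB.
- pose gp x := Num.max 0%R (c - (u x - v x))%R.
  pose gn x := Num.max 0%R (- (c - (u x - v x)))%R.
  have mg : measurable_fun setT (fun x => c - (u x - v x))%R.
    by apply: measurable_funB => //; exact: measurable_funB.
  have mgp : measurable_fun setT gp by exact: measurable_maxr.
  have mgn : measurable_fun setT gn.
    by apply: measurable_maxr => //; exact: measurableT_comp.
  have gp0 x : (0 <= gp x)%R by rewrite le_max lexx.
  have gn0 x : (0 <= gn x)%R by rewrite le_max lexx.
  (* The identity [gp - gn = c - (u - v)], rearranged into sums of nonnegative terms so that it can
     be integrated termwise. *)
  have pt x : (gp x)%:E + (u x)%:E = (gn x)%:E + (v x)%:E + c%:E.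
    rewrite -!EFinD; congr EFin; rewrite /gp /gn /Num.max.
    by do ! case: ifPn; rewrite -?leNgt; lra.
  have : \int[nu]_x (gp x)%:E + b%:E = \int[nu]_x (gn x)%:E + a + c%:E.
    rewrite fineK// -Uint -Vint -ge0_integralD//; last 4 first.
    - by move=> x _; rewrite lee_fin.
    - exact/measurable_EFinP.
    - by move=> x _; rewrite lee_fin.
    - exact/measurable_EFinP.
    under eq_integral do rewrite pt.
    rewrite ge0_integralD//; last 3 first.
    - by move=> x _; rewrite adde_ge0// lee_fin.
    - by apply: emeasurable_funD; exact/measurable_EFinP.
    - by move=> x _; rewrite lee_fin ltW.
    rewrite ge0_integralD//; last 4 first.
    - by move=> x _; rewrite lee_fin.
    - exact/measurable_EFinP.
    - by move=> x _; rewrite lee_fin.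
    - exact/measurable_EFinP.
    by rewrite integral_cst_probability.
  have gpfin : \int[nu]_x (gp x)%:E < +oo.
    apply: (@le_lt_trans _ _ (\int[nu]_x ((v x)%:E + c%:E))).
      apply: ge0_le_integral => //.
      - by move=> x _; rewrite lee_fin.
      - exact/measurable_EFinP.
      - by apply: emeasurable_funD => //; exact/measurable_EFinP.
      - move=> x _; rewrite -EFinD lee_fin /gp ge_max.
        by move: (u0 x) (v0 x) c0; lra.
    rewrite ge0_integralD//; last 3 first.
    - by move=> x _; rewrite lee_fin.
    - exact/measurable_EFinP.
    - by move=> x _; rewrite lee_fin ltW.
    rewrite integral_cst_probability Vint.
    by rewrite lte_add_pinfty// ?ltry// -ge0_fin_numE.
  have Gp0 : 0 <= \int[nu]_x (gp x)%:E by apply: integral_ge0 => x _; rewrite lee_fin.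
  have Gn0 : 0 <= \int[nu]_x (gn x)%:E by apply: integral_ge0 => x _; rewrite lee_fin.
  rewrite -/gp -/gn -[a]fineK//.
  move: gpfin Gp0 Gn0 c0; rewrite /c.
  case: (\int[nu]_x (gp x)%:E) => [p|//|//] _ _.
  case: (\int[nu]_x (gn x)%:E) => [q|_ _|//] /=; last by rewrite ltry.
  by rewrite lte_fin => _ c0 [] h; move: h c0; lra.
- move: vE; apply: filterS => x vx.
  rewrite (_ : (c - _)%R = u x - v x)%R; last by lra.
  have -> : W x = W^\+ x - W^\- x by rewrite [in LHS](funeposneg W).
  rewrite EFinB vx uE.
  by apply: leeB => //; rewrite ge_min lexx.
Unshelve. all: by end_near. Qed.

(** The real minorants [y j] avoid sums of possibly infinite values of [W]. They are [c - g (w j)],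
    with [c] and [g] from the truncation, and [K] bounds the partial sums of [g]. *)
Lemma iid_linear_lower_bound (W : T -> \bar R) :
  measurable_fun setT W -> 0 < \int[nu]_x W x ->
  exists2 c : R, (0 < c)%R &
    {ae P, forall w : nat -> T, exists (y : nat -> R) (K : R),
       (forall j, (y j)%:E <= W (w j)) /\
       (forall n, (c * n%:R - K <= \sum_(j < n) y j)%R)}.
Proof.
move=> mW W0.
have [c [g [c0 mg gdrift cg]]] := truncation_positive_mean mW W0.
exists c => //.
apply: ae_imp2 (ae_all_coordinates cg) (partial_sums_bounded iidP mg gdrift).
move=> w cgw [K gK]; exists (fun j => c - g (w j))%R, K; split => // n.
by rewrite sumrB sumr_const card_ord mulr_natr lerB.
Qed.

End iid_sequence_bounds.

(** * Densities and relative entropy *)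

Section extended_real_measurability.
Context d (T : measurableType d) (R : realType).
Implicit Types f g : T -> \bar R.

Lemma measurable_fun_inve f : measurable_fun setT f -> (forall x, 0 <= f x) ->
  measurable_fun setT (fun x => (f x)^-1).
Proof.
move=> mf f0.
rewrite (_ : (fun x => _) = (fun x => if f x == 0 then +oo else
    if f x == +oo then 0 else (expR (- ln (fine (f x))))%:E)); last first.
  apply/funext => x; have := f0 x; case: (f x) => [r|_|//] /=; last by rewrite invey.
  rewrite lee_fin eqe inver => r0; case: ifPn => // r1.
  by rewrite expRN lnK// posrE lt_neqAle eq_sym r1.
apply: measurable_fun_ifT => //; first exact: measurable_fun_eqe.
apply: measurable_fun_ifT => //; first exact: measurable_fun_eqe.
apply/measurable_EFinP; apply: (measurableT_comp (@measurable_expR R)).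
apply: measurable_funN; apply: (measurableT_comp (@measurable_ln R)).
exact: measurableT_comp.
Qed.

Lemma measurable_fun_lne f : measurable_fun setT f ->
  measurable_fun setT (fun x => lne (f x)).
Proof.
move=> mf.
rewrite (_ : (fun x => _) = (fun x => if f x <= 0 then -oo else
    if f x == +oo then +oo else (ln (fine (f x)))%:E)); last first.
  by apply/funext => x; case: (f x) => [r| |]; rewrite ?lee_fin ?leye_eq ?leNye.
apply: measurable_fun_ifT => //; first exact: measurable_fun_lee.
apply: measurable_fun_ifT => //; first exact: measurable_fun_eqe.
apply/measurable_EFinP; apply: (measurableT_comp (@measurable_ln R)).
exact: measurableT_comp.
Qed.

Lemma measurable_fun_dive f g : measurable_fun setT f -> measurable_fun setT g ->
  (forall x, 0 <= g x) -> measurable_fun setT (fun x => f x / g x).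
Proof. by move=> mf mg g0; apply: emeasurable_funM => //; exact: measurable_fun_inve. Qed.

Lemma measurable_fun_prode (n : nat) (h : nat -> T -> \bar R) :
  (forall j, measurable_fun setT (h j)) ->
  measurable_fun setT (fun x => \prod_(j < n) h j x).
Proof.
move=> mh; elim: n => [|n ih].
  by under eq_fun do rewrite big_ord0; exact: measurable_cst.
by under eq_fun do rewrite big_ord_recr /=; exact: emeasurable_funM.
Qed.

End extended_real_measurability.

(** * Integration against a density *)

Section density.
Context d (T : measurableType d) (R : realType).
Variables (kappa : {measure set T -> \bar R}) (nu : probability T R).
Variable f : T -> \bar R.
Hypotheses (mf : measurable_fun setT f) (f0 : forall x, 0 <= f x).
Hypothesis nuf : has_density kappa nu f.

Import HBNNSimple.

(** Simple functions reduce this to the definition of a density, and both sides pass to monotone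
    limits. *)
Lemma integral_density (g : T -> \bar R) A :
  measurable A -> measurable_fun setT g -> (forall x, 0 <= g x) ->
  \int[nu]_(x in A) g x = \int[kappa]_(x in A) (g x * f x).
Proof.
move=> mA mg g0; pose h := nnsfun_approx measurableT mg.
have hg x : EFin \o h ^~ x @ \oo --> g x.
  by apply: cvg_nnsfun_approx => //.
have ndh x : nondecreasing_seq (fun n => (h n x)%:E).
  by move=> a b ab; rewrite lee_fin; exact/lefP/nd_nnsfun_approx.
have mh n : measurable_fun setT (fun x => (h n x)%:E).
  by apply/measurable_EFinP.
have -> : \int[nu]_(x in A) g x = limn (fun n => \int[nu]_(x in A) (h n x)%:E).
  have gE x : g x = limn (fun n => (h n x)%:E) by apply/esym/cvg_lim => //; exact: hg.
  under eq_integral do rewrite gE.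
  apply: monotone_convergence => //.
  - by move=> n; exact: measurable_funTS.
  - by move=> n x _; rewrite lee_fin.
have -> : \int[kappa]_(x in A) (g x * f x) =
    limn (fun n => \int[kappa]_(x in A) ((h n x)%:E * f x)).
  have gE x : g x * f x = limn (fun n => (h n x)%:E * f x).
    apply/esym/cvg_lim => //; have := f0 x; case: (f x) => [r|_|//].
      by move=> _; apply: cvgeZr => //; exact: hg.
    (* At a point where the density is [+oo], multiplication is not continuous. There the products
       are all 0 if [g x = 0], and otherwise are [+oo] as soon as the simple functions become
       positive. *)
    have gsup : g x = ereal_sup (range (fun n => (h n x)%:E)).
      exact: cvg_unique (hg x) (ereal_nondecreasing_cvgn (ndh x)).
    have [gx0|gx0] := eqVneq (g x) 0.
      rewrite gx0 mul0e (_ : (fun n => _) = fun=> 0); first exact: cvg_cst.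
      apply/funext => n; rewrite (_ : (h n x)%:E = 0) ?mul0e//.
      have hn0 : 0 <= (h n x)%:E by rewrite lee_fin.
      apply/eqP; rewrite eq_le hn0 andbT -gx0.
      by rewrite gsup; apply: ereal_sup_ubound; exists n.
    have {}gx0 : 0 < g x by rewrite lt_neqAle eq_sym gx0 g0.
    rewrite gt0_muley//; apply: cvg_near_cst.
    move: gx0; rewrite gsup => /ereal_sup_gt[_ [n _ <-] hn].
    by exists n => // k nk /=; rewrite gt0_muley// (lt_le_trans hn)// ndh.
  under eq_integral do rewrite gE.
  apply: monotone_convergence => //.
  - by move=> n; apply: measurable_funTS; exact: emeasurable_funM.
  - by move=> n x _; rewrite mule_ge0// lee_fin.
  - by move=> x _ a b ab; rewrite lee_wpmul2r//; exact: ndh.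
congr (limn _); apply/funext => n.
transitivity (\int[nu]_(x in A)
   (\sum_(y \in range (h n)) (y * \1_(h n @^-1` [set y]) x)%:E)).
  by apply: eq_integral => t tE; rewrite /= fimfunE -fsumEFin.
have indich r : measurable_fun A (fun x => (r * \1_(h n @^-1` [set r]) x)%:E).
  by apply: (measurable_comp measurableT) => //; exact: measurable_funM.
rewrite ge0_integral_fsum//; last by move=> m y Ey; exact: nnfun_muleindic_ge0.
transitivity (\int[kappa]_(x in A) (\sum_(y \in range (h n))
    (y * \1_(h n @^-1` [set y]) x)%:E * f x)); last first.
  under [RHS]eq_integral => x xE.
    rewrite fimfunE -fsumEFin// ge0_mule_fsuml => [|y]; last exact: nnfun_muleindic_ge0.
    over.
  by [].
rewrite ge0_integral_fsum//; last 2 first.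
  - by move=> y; apply: emeasurable_funM => //; apply: measurable_funTS.
  - by move=> m y Ey; rewrite mule_ge0// nnfun_muleindic_ge0.
apply: eq_fsbigr => r rhn.
under eq_integral do rewrite EFinM.
rewrite integralZl_indic_nnsfun => //.
under [RHS]eq_integral do rewrite EFinM -muleA.
rewrite ge0_integralZl//.
- under [in RHS]eq_integral do rewrite muleC.
  rewrite [X in _ = _ * X](eq_integral (f \_ (h n @^-1` [set r]))); last first.
    by move=> x xE; rewrite epatch_indic.
  by rewrite -integral_mkcondr -nuf ?integral_indic// setIC//; exact: measurableI.
- apply: emeasurable_funM; first exact/measurable_EFinP.
  exact/measurable_funTS.
- by move=> t Et; rewrite mule_ge0 ?lee_fin.
- by move: rhn; rewrite inE => -[t _ <-]; rewrite lee_fin.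
Qed.

Lemma density_integral1 : \int[kappa]_x f x = 1.
Proof. by rewrite -nuf// probability_setT. Qed.

Lemma density_null A : measurable A -> (forall x, A x -> f x = 0) -> nu A = 0.
Proof. by move=> mA fA; rewrite nuf// integral0_eq. Qed.

Lemma null_dominating_density A : measurable A -> kappa A = 0 -> nu A = 0.
Proof.
move=> mA kA; rewrite nuf//.
rewrite (@ge0_negligible_integral _ _ _ _ A A)//; last exact: measurable_funTS.
by rewrite setDv integral_set0.
Qed.

Lemma density_infinite_null : kappa [set x | f x = +oo] = 0.
Proof.
have fi : kappa.-integrable setT f.
  apply/integrableP; split => //; under eq_integral do rewrite gee0_abs//.
  by rewrite density_integral1 ltry.
have mA : measurable [set x | f x = +oo].
  by rewrite -[X in measurable X]setTI; exact: measurable_eqe.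
apply/(negligibleP _ mA).
have := integrable_ae measurableT fi; apply: negligibleS => x /= fx.
by move=> /(_ I); rewrite fx.
Qed.

(** The zeros of [f] carry no [nu]-mass; the points where [f] is infinite form a [kappa]-null set,
    since [f] has integral 1. *)
Lemma density_pos_ae : {ae nu, forall x, 0 < f x < +oo}.
Proof.
have mz : measurable [set x | f x = 0].
  by rewrite -[X in measurable X]setTI; exact: measurable_eqe.
have mA : measurable [set x | f x = +oo].
  by rewrite -[X in measurable X]setTI; exact: measurable_eqe.
exists ([set x | f x = 0] `|` [set x | f x = +oo]); split.
- exact: measurableU.
- apply/(negligibleP _ (measurableU _ _ mz mA)); apply: negligibleU.
    by apply/(negligibleP _ mz); exact: density_null.
  apply/(negligibleP _ mA); apply: null_dominating_density => //.
  exact: density_infinite_null.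
- move=> x /= /negP; rewrite negb_and -!leNgt leye_eq => /orP[fx|/eqP]; last by right.
  by left; apply/eqP; rewrite eq_le fx f0.
Qed.

End density.

(** * Log-ratios of densities and relative entropy *)

Section likelihood_ratio.
Context d (T : measurableType d) (R : realType).
Variables (kappa : {measure set T -> \bar R}) (nu0 nu : probability T R).
Variables f0 f : T -> \bar R.
Hypotheses (mf0 : measurable_fun setT f0) (f00 : forall x, 0 <= f0 x).
Hypotheses (mf : measurable_fun setT f) (fge0 : forall x, 0 <= f x).
Hypotheses (nuf0 : has_density kappa nu0 f0) (nuf : has_density kappa nu f).

(** Written against [kappa], the integrand [f / f0 * f0] is [f] where [0 < f0 < +oo] and 0 where
    [f0 = 0]; the remaining set is [kappa]-null and [f] has integral 1. *)
Lemma integral_inverse_ratio_le1 : \int[nu0]_x (f x / f0 x) <= 1.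
Proof.
have mr : measurable_fun setT (fun x => f x / f0 x) by exact: measurable_fun_dive.
have r0 x : 0 <= f x / f0 x by rewrite mule_ge0// inve_ge0.
rewrite (integral_density mf0 f00 nuf0)//.
rewrite -(density_integral1 nuf).
apply: ae_ge0_le_integral => //.
- by move=> x _; rewrite mule_ge0.
- exact: emeasurable_funM.
have mA : measurable [set x | f0 x = +oo].
  by rewrite -[X in measurable X]setTI; exact: measurable_eqe.
have := density_infinite_null mf0 f00 nuf0; move=> /(negligibleP _ mA).
apply: negligibleS => x /= h; apply: contrapT => f0x; apply: h => _.
have [->|fx0] := eqVneq (f0 x) 0; first by rewrite mule0.
rewrite -muleA; have := f00 x; move: f0x fx0; case: (f0 x) => [r| |//]; last by [].
by rewrite eqe => _ r0' _; rewrite inver (negbTE r0') -EFinM mulVf// mule1.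
Qed.

Let X x := lne (f0 x / f x).

Lemma measurable_log_ratio : measurable_fun setT X.
Proof. by apply: measurable_fun_lne; exact: measurable_fun_dive. Qed.

(** From [ln t <= t] at [t = f / f0]. It makes the log-ratio quasi-integrable. *)
Let lratio_neg x : 0 < f0 x < +oo -> X^\- x <= f x / f0 x.
Proof.
move=> f0x; rewrite funenegE /X ge_max mule_ge0 ?inve_ge0// andbT leeNl.
move: f0x; case: (f0 x) => [a||]; rewrite ?ltxx ?andbF// lte_fin => /andP[a0 _].
have ai : a%:E^-1 = (a^-1)%:E by rewrite inver gt_eqF.
have := fge0 x; case: (f x) => [b|_|//].
  rewrite lee_fin le_eqVlt => /predU1P[<-|b0].
    by rewrite inve0 gt0_muley ?lte_fin//= leey.
  rewrite ai inver gt_eqF// -!EFinM -EFinN lne_EFin ?divr_gt0// lee_fin.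
  rewrite -[leRHS]opprK lerN2 -lnV ?posrE ?divr_gt0// invf_div.
  by apply: ltW; apply: ln_sublinear; rewrite divr_gt0.
by rewrite ai gt0_mulye ?lte_fin ?invr_gt0//= leNye.
Qed.

Lemma integral_log_ratio_neg_le1 : \int[nu0]_x X^\- x <= 1.
Proof.
apply: le_trans integral_inverse_ratio_le1.
apply: ae_ge0_le_integral => //.
- by apply: measurable_funeneg; exact: measurable_log_ratio.
- by move=> x _; rewrite mule_ge0// inve_ge0.
- exact: measurable_fun_dive.
have := density_pos_ae mf0 f00 nuf0.
by apply: filterS => x f0x _; exact: lratio_neg.
Qed.

Let mz : measurable [set x | f x = 0].
Proof. by rewrite -[X in measurable X]setTI; exact: measurable_eqe. Qed.

(** For the converse, a [nu]-null set splits into its part in [f = 0], null by assumption, and the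
    rest, which is [kappa]-null because [f] is positive there with zero integral. *)
Lemma dominated_by_density : nu0 `<< nu <-> nu0 [set x | f x = 0] = 0.
Proof.
split=> [dom|nu0Z].
  have nuZ : nu [set x | f x = 0] = 0 by exact: density_null nuf _ mz _.
  by have /dom/(_ _ mz) : nu.-null_set [set x | f x = 0];
    [exact/(measure0_null_setP _ mz)|apply].
move=> N nuN A mA AN; have nuA := nuN A mA AN.
have mAZ : measurable (A `\` [set x | f x = 0]) by exact: measurableD.
have kAZ : kappa (A `\` [set x | f x = 0]) = 0.
  apply/(negligibleP _ mAZ).
  have /ae_eq_integral_abs : \int[kappa]_(x in A) `|f x| = 0.
    by under eq_integral do rewrite gee0_abs//; rewrite -nuf.
  move=> /(_ mA (measurable_funTS mf)); apply: negligibleS => x [Ax fx] /=.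
  by move=> /(_ Ax).
apply/(negligibleP _ mA).
apply: (@negligibleS _ _ _ _ ([set x | f x = 0] `|` (A `\` [set x | f x = 0]))).
  by move=> x Ax; have [fx|fx] := pselect (f x = 0); [left|right].
apply: negligibleU; first exact/(negligibleP _ mz).
by apply/(negligibleP _ mAZ); exact: (null_dominating_density mf0 f00 nuf0).
Qed.

Lemma integral_ratio_dominated A : nu0 `<< nu -> measurable A ->
  \int[nu]_(x in A) (f0 x / f x) = nu0 A.
Proof.
move=> dom mA.
have [N [mN nuN NG]] := density_pos_ae mf fge0 nuf.
have nu0N : nu0 N = 0.
  by have /dom/(_ _ mN) : nu.-null_set N; [exact/(measure0_null_setP _ mN)|apply].
have mr : measurable_fun setT (fun x => f0 x / f x) by exact: measurable_fun_dive.
have r0 x : 0 <= f0 x / f x by rewrite mule_ge0// inve_ge0.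
rewrite (@ge0_negligible_integral _ _ _ _ A N)//; last exact: measurable_funTS.
rewrite (integral_density mf fge0 nuf)//; last exact: measurableD.
transitivity (\int[kappa]_(x in A `\` N) f0 x).
  apply: eq_integral => x; rewrite inE => -[_ Nx].
  have : 0 < f x < +oo by apply: contrapT => /NG.
  case: (f x) => [r||]; rewrite ?ltxx ?andbF// lte_fin => /andP[x0 _].
  by rewrite inver gt_eqF// -muleA -EFinM mulVf ?gt_eqF// mule1.
rewrite -nuf0; last exact: measurableD.
have AN0 : nu0 (A `&` N) = 0.
  apply/eqP; rewrite -measure_le0 -nu0N le_measure ?inE//.
  exact: measurableI.
have -> : nu0 A = nu0 (A `\` N) + nu0 (A `&` N) by exact: measureDI.
by rewrite AN0 adde0.
Qed.

Local Open Scope charge_scope.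
(** Under domination [f0 / f] is a version of the Radon-Nikodym derivative. Otherwise [nu0] charges
    [f = 0], where the log-ratio is [+oo]; its negative part being integrable, both sides are
    [+oo]. *)
Lemma KL_log_ratio : KL nu0 nu = \int[nu0]_x lne (f0 x / f x).
Proof.
rewrite /KL; case: asboolP => [dom|ndom].
  have RNs : ae_eq nu setT ('d (charge_of_finite_measure nu0) '/d nu)%E
      (fun x => f0 x / f x).
    apply: integral_ae_eq => //.
    - exact: Radon_Nikodym_integrable.
    - exact: measurable_fun_dive.
    - move=> E _ mE; rewrite integral_ratio_dominated//.
      by rewrite -Radon_Nikodym_integral.
  apply: ae_eq_integral => //.
  - apply: measurable_fun_lne; apply: measurable_int.
    exact: Radon_Nikodym_integrable.
  - exact: measurable_log_ratio.
  - case: RNs => N [mN nuN NE]; exists N; split => //.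
    + by have /dom/(_ _ mN) : nu.-null_set N; [exact/(measure0_null_setP _ mN)|apply].
    + move=> x /= h; apply: NE => /= e; apply: h => _.
      by rewrite e.
apply/esym; rewrite integralE.
have Xneg_fin : \int[nu0]_x X^\- x \is a fin_num.
  rewrite ge0_fin_numE ?integral_ge0//.
  by apply: le_lt_trans integral_log_ratio_neg_le1 _; rewrite ltry.
suff -> : \int[nu0]_x X^\+ x = +oo by rewrite -(fineK Xneg_fin) -EFinN addye.
(* The condition [0 < f0] removes only a [nu0]-null set and avoids the quotient [0 / 0]. *)
pose Z := [set x | f x = 0] `&` [set x | 0 < f0 x].
have mZ : measurable Z.
  apply: measurableI => //; rewrite -[X in measurable X]setTI.
  exact: measurable_lte.
have nu0Z : 0 < nu0 Z.
  rewrite lt_neqAle measure_ge0 andbT eq_sym; apply/eqP => Z0; apply: ndom.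
  apply/dominated_by_density; apply/(negligibleP _ mz).
  have := density_pos_ae mf0 f00 nuf0.
  move=> pos; apply: (@negligibleS _ _ _ _ (Z `|` ~` [set x | 0 < f0 x < +oo])).
    move=> x fx; have [h|h] := pselect (0 < f0 x < +oo); last by right.
    by left; split => //; case/andP: h.
  by apply: negligibleU => //; exact/(negligibleP _ mZ).
apply/eqP; rewrite eq_le leey /=.
apply: (@le_trans _ _ (\int[nu0]_(x in Z) X^\+ x)); last first.
  apply: ge0_subset_integral => //.
  by apply: measurable_funepos; exact: measurable_log_ratio.
rewrite (eq_integral (cst +oo)); last first.
  move=> x; rewrite inE => -[/= fx f0x].
  by rewrite funeposE /X fx inve0 gt0_muley//= maxye.
by rewrite integral_cst// gt0_mulye.
Qed.

End likelihood_ratio.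

(** [W x] is the essential infimum of [l x] for [Q] restricted to [N]. It is at least [r] exactly
    when the section of points of [N] with [l x < r] is [Q]-null, and the [Q]-measure of a section
    depends measurably on [x]. *)
Lemma measurable_ess_inf_bound d d' (T : measurableType d)
    (Phi : measurableType d') (R : realType) (Q : probability Phi R)
    (l : T -> Phi -> \bar R) (N : set Phi) :
  measurable N -> measurable_fun setT (fun z : T * Phi => l z.1 z.2) ->
  exists W : T -> \bar R, [/\ measurable_fun setT W,
    forall x, ereal_inf [set l x phi | phi in N] <= W x &
    forall x, {ae Q, forall phi, N phi -> W x <= l x phi}].
Proof.
move=> mN ml.
have mlx x : measurable_fun setT (l x).
  exact: (measurableT_comp ml (measurable_pair1 x)).
have aeE (A : set Phi) : {ae mrestr Q mN, forall phi, A phi} <->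
    {ae Q, forall phi, N phi -> A phi}.
  split=> [[B [mB B0 BA]]|[B [mB B0 BA]]].
    exists (B `&` N); split => //; first exact: measurableI.
    move=> phi /= /not_implyP[Nphi nA]; split => //; exact: BA.
  exists (B `|` ~` N); split.
  - by apply: measurableU => //; exact: measurableC.
  - rewrite /mrestr setIUl setICl setU0; apply/eqP; rewrite -measure_le0 -B0.
    by rewrite le_measure// inE//; exact: measurableI.
  - move=> phi /= nA; have [Np|] := pselect (N phi); last by right.
    by left; apply: BA => /(_ Np).
pose W x := ess_inf (mrestr Q mN) (l x).
exists W; split.
- move=> _; apply: (measurability _ (ErealGenCInfty.measurableE R)) => //.
  move=> _ [_ [r ->] <-]; rewrite setTI.
  pose B := [set z : T * Phi | N z.2 /\ l z.1 z.2 < r%:E].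
  have mB : measurable B.
    have -> : B = (setT `*` N) `&` (setT `&` [set z | l z.1 z.2 < r%:E]).
      by apply/seteqP; split => z /=; [move=> []|move=> [[_ ?] [_ ?]]].
    by apply: measurableI; [exact: measurableX|exact: measurable_lte].
  rewrite (_ : _ @^-1` _ = setT `&` [set x | Q (xsection B x) = 0]).
    by apply: measurable_eqe => //; exact: measurable_fun_xsection.
  have mBx x : measurable (xsection B x) by exact: measurable_xsection.
  apply/seteqP; split => x /=; rewrite in_itv /= andbT.
    move=> /ess_infP/aeE h; split => //; apply/(negligibleP _ (mBx x)).
    apply: negligibleS h => phi; rewrite /xsection /= inE => -[Np lr] /= /(_ Np).
    by rewrite leNgt lr.
  move=> [_ /(negligibleP _ (mBx x)) h]; apply/ess_infP/aeE.
  apply: negligibleS h => phi /= /not_implyP[Np /negP].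
  by rewrite -ltNge /xsection /= inE.
- move=> x; apply/ess_infP/aeE; apply: aeW => phi Np.
  by apply: ereal_inf_lbound; exists phi.
- by move=> x; apply/aeE; exact: ess_inf_le.
Qed.

Lemma ae_null_xsection d1 d2 (T1 : measurableType d1) (T2 : measurableType d2)
    (R : realType) (m1 : probability T1 R) (m2 : probability T2 R)
    (B : set (T1 * T2)) :
  measurable B -> (forall y, m1 (ysection B y) = 0) ->
  {ae m1, forall x, m2 (xsection B x) = 0}.
Proof.
move=> mB B0.
have : \int[m1]_x `|m2 (xsection B x)| = 0.
  under eq_integral do rewrite gee0_abs//.
  have := indic_fubini_tonelli m1 m2 mB.
  rewrite indic_fubini_tonelli_FE// indic_fubini_tonelli_GE// => ->.
  by apply: integral0_eq => y _ /=.
move=> /(ae_eq_integral_abs _ measurableT (measurable_fun_xsection m2 mB)).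
by apply: filterS => x; apply.
Qed.

(** * Inequalities between extended-real ratios and their logarithms *)

Section ratio_bounds.
Context (R : realType).
Implicit Types a b : \bar R.

Lemma lne_ratio_ge a b (y : R) : 0 < a < +oo -> 0 <= b ->
  y%:E <= lne (a / b) -> b <= (expR (- y))%:E * a.
Proof.
case: a => [a||]; rewrite ?ltxx ?andbF// lte_fin => /andP[a0 _].
case: b => [b|_|//]; last by rewrite invey mule0 /= lexx.
rewrite lee_fin le_eqVlt => /predU1P[<- _|b0].
  by rewrite mule_ge0// lee_fin ?expR_ge0// ltW.
rewrite inver gt_eqF// -EFinM lne_EFin ?divr_gt0// lee_fin => h.
rewrite -EFinM lee_fin expRN -ler_pdivrMl ?invr_gt0 ?expR_gt0// invrK.
by rewrite -ler_pdivlMr// -(@lnK _ (a / b)%R) ?posrE ?divr_gt0// ler_expR.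
Qed.

Lemma lne_ratio_le a b (z : R) : 0 < a < +oo -> 0 <= b ->
  lne (a / b) <= z%:E -> (expR (- z))%:E * a <= b.
Proof.
case: a => [a||]; rewrite ?ltxx ?andbF// lte_fin => /andP[a0 _].
case: b => [b|_ _|//]; last by rewrite leey.
rewrite lee_fin le_eqVlt => /predU1P[<-|b0].
  by rewrite inve0 gt0_muley ?lte_fin//=.
rewrite inver gt_eqF// -EFinM lne_EFin ?divr_gt0// lee_fin => h.
rewrite -EFinM lee_fin expRN ler_pdivrMl ?expR_gt0//.
by rewrite -ler_pdivrMr// -[leLHS](@lnK _ (a / b)%R) ?posrE ?divr_gt0// ler_expR.
Qed.

(** Lets the normalising constants cancel in every log-ratio, including zero and infinite values. *)
Lemma dive_scale (c : R) a b : (0 < c)%R -> 0 <= a -> 0 <= b ->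
  (c%:E * a) / (c%:E * b) = a / b.
Proof.
move=> c0; case: a => [a a0|_|//]; case: b => [b b0|_|//].
- rewrite -!EFinM !inver mulf_eq0 gt_eqF//=.
  case: ifPn => [_|b1].
    move: a0; rewrite lee_fin le_eqVlt => /predU1P[<-|a0].
      by rewrite mulr0 mul0e.
    by rewrite !gt0_muley ?lte_fin ?mulr_gt0.
  by rewrite -!EFinM invfM mulrACA divff ?gt_eqF// mul1r.
- by rewrite gt0_muley ?lte_fin// !invey !mule0.
- rewrite gt0_muley ?lte_fin// -EFinM !inver mulf_eq0 gt_eqF//=.
  case: ifPn => // b1; rewrite !gt0_mulye// lte_fin invr_gt0 ?mulr_gt0//;
  by rewrite lt_neqAle eq_sym b1.
- by rewrite gt0_muley ?lte_fin// !invey !mule0.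
Qed.

End ratio_bounds.

(** By independence of head and tail, each induction step splits off one factor of integral at most
    1. *)
Lemma integral_prod_coordinates_le1 d (T : measurableType d) (R : realType)
    (nu : probability T R) (P : probability (sequence_space T) R)
    (r : T -> \bar R) (n : nat) :
  is_product_probability (fun=> nu) P ->
  measurable_fun setT r -> (forall x, 0 <= r x) -> \int[nu]_x r x <= 1 ->
  \int[P]_w \prod_(j < n) r ((w : nat -> T) j) <= 1.
Proof.
move=> iidP mr r0 r1; elim: n => [|n ih].
  by under eq_integral do rewrite big_ord0; rewrite integral_cst_probability.
under eq_integral do rewrite big_ord_recl /=.
have mp : measurable_fun setT
    (fun w : sequence_space T => \prod_(j < n) r ((w : nat -> T) j)).
  apply: (@measurable_fun_prode _ _ _ n (fun j (w : sequence_space T) => r ((w : nat -> T) j))).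
  by move=> j; exact: (measurableT_comp mr (@measurable_coord _ T j)).
have p0 (w : sequence_space T) : 0 <= \prod_(j < n) r ((w : nat -> T) j).
  by apply: prode_ge0 => j _.
pose f (z : T * sequence_space T) := r z.1 * \prod_(j < n) r ((z.2 : nat -> T) j).
have mf : measurable_fun setT f.
  apply: emeasurable_funM; first exact: measurableT_comp.
  exact: (measurableT_comp mp).
have f0 z : 0 <= f z by rewrite mule_ge0.
rewrite (integral_head_shift iidP mf f0) fubini_tonelli1//.
rewrite /fubini_F /f /=.
under eq_integral do rewrite ge0_integralZl//.
rewrite ge0_integralZr//; last exact: integral_ge0.
rewrite -[leRHS]mule1; apply: lee_pmul => //; exact: integral_ge0.
Qed.

(** * Likelihood ratios and posterior concentration *)

Section posterior_concentration.
Context d d' (T : measurableType d) (Phi : measurableType d') (R : realType).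
Variables (nu : probability T R) (P : probability (sequence_space T) R).
Variables (Q : probability Phi R) (a : T -> Phi -> \bar R) (phi0 : Phi).
Hypothesis iidP : is_product_probability (fun=> nu) P.
Hypothesis ma : measurable_fun setT (fun z : T * Phi => a z.1 z.2).
Hypothesis a_ge0 : forall x phi, 0 <= a x phi.
Hypothesis a_pos : {ae nu, forall x, 0 < a x phi0 < +oo}.

Definition likelihood (n : nat) (w : nat -> T) (phi : Phi) : \bar R :=
  \prod_(j < n) a (w j) phi.

Local Notation L := likelihood.

Lemma likelihood_ge0 n w phi : 0 <= L n w phi.
Proof. exact: prode_ge0. Qed.

Lemma measurable_observation j : measurable_fun setT
  (fun z : sequence_space T * Phi => ((z.1 : nat -> T) j, z.2)).
Proof.
apply: measurable_fun_pair => //.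
exact: (measurableT_comp (@measurable_coord _ T j) measurable_fst).
Qed.

Lemma measurable_likelihood n :
  measurable_fun setT (fun z : sequence_space T * Phi => L n z.1 z.2).
Proof.
apply: (@measurable_fun_prode _ _ _ n (fun j (z : sequence_space T * Phi) =>
  a ((z.1 : nat -> T) j) z.2)) => j.
exact: (measurableT_comp ma (measurable_observation j)).
Qed.

Lemma measurable_likelihood_at n (w : nat -> T) : measurable_fun setT (L n w).
Proof.
exact: (measurableT_comp (measurable_likelihood n)
  (@measurable_pair1 _ _ (sequence_space T) _ w)).
Qed.

Lemma likelihood_phi0_gt0 n (w : nat -> T) :
  (forall j, 0 < a (w j) phi0 < +oo) -> 0 < L n w phi0 < +oo.
Proof.
move=> h; rewrite /L; elim: n => [|n]; first by rewrite big_ord0 lte01 ltry.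
rewrite big_ord_recr /= => /andP[p1 p2]; have /andP[q1 q2] := h n.
by rewrite mule_gt0// lte_mul_pinfty// ?ltW// ge0_fin_numE// ltW.
Qed.

Lemma likelihood_factor_le n (w : nat -> T) (y : nat -> R) phi :
  (forall j, (j < n)%N -> a (w j) phi <= (expR (y j))%:E * a (w j) phi0) ->
  L n w phi <= (expR (\sum_(j < n) y j))%:E * L n w phi0.
Proof.
rewrite /L; elim: n => [|n ih] h; first by rewrite !big_ord0 expR0 mule1.
rewrite !big_ord_recr /= expRD EFinM muleACA.
apply: lee_pmul => //; [exact: prode_ge0| |exact: h].
by apply: ih => j jn; apply: h; rewrite ltnS ltnW.
Qed.

Lemma likelihood_factor_ge n (w : nat -> T) (y : nat -> R) phi :
  (forall j, (j < n)%N -> (expR (y j))%:E * a (w j) phi0 <= a (w j) phi) ->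
  (expR (\sum_(j < n) y j))%:E * L n w phi0 <= L n w phi.
Proof.
rewrite /L; elim: n => [|n ih] h; first by rewrite !big_ord0 expR0 mule1.
rewrite !big_ord_recr /= expRD EFinM muleACA.
apply: lee_pmul; [|  | apply: ih => j jn; apply: h; rewrite ltnS ltnW// |exact: h].
- by rewrite mule_ge0 ?lee_fin ?expR_ge0//; exact: prode_ge0.
- by rewrite mule_ge0 ?lee_fin ?expR_ge0.
Qed.

(** The rate [c] is deterministic while [K] depends on the sample; the reference is the likelihood
    at [phi0], and the notion is stable under finite unions. *)
Definition exp_small (F : set Phi) := exists2 c : R, (0 < c)%R &
  {ae P, forall w : nat -> T, exists K : R, forall n,
    \int[Q]_(phi in F) L n w phi <= (expR (K - c * n%:R))%:E * L n w phi0}.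

Lemma exp_small_set0 : exp_small set0.
Proof.
exists 1%R => //; apply: aeW => w; exists 0%R => n.
by rewrite integral_set0 mule_ge0 ?lee_fin ?expR_ge0// likelihood_ge0.
Qed.

Lemma exp_smallS F G : measurable F -> measurable G -> F `<=` G ->
  exp_small G -> exp_small F.
Proof.
move=> mF mG FG [c c0 h]; exists c => //.
apply: ae_imp h => w [K hK]; exists K => n.
apply: le_trans (hK n); apply: ge0_subset_integral => //.
- by apply: measurable_funTS; exact: measurable_likelihood_at.
- by move=> phi _; exact: likelihood_ge0.
Qed.

Lemma exp_smallU F G : measurable F -> measurable G ->
  exp_small F -> exp_small G -> exp_small (F `|` G).
Proof.
move=> mF mG [c1 c10 h1] [c2 c20 h2]; exists (Num.min c1 c2).
  by rewrite lt_min c10.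
apply: ae_imp2 h1 h2 => w [K1 h1] [K2 h2].
(* The extra 1 absorbs the sum of two equal bounds, since [2 <= expR 1]. *)
exists (Num.max K1 K2 + 1)%R => n.
have mL (S : set Phi) : measurable_fun S (L n w).
  by apply: measurable_funTS; exact: measurable_likelihood_at.
have L0 (S : set Phi) : forall phi, S phi -> 0 <= L n w phi.
  by move=> phi _; exact: likelihood_ge0.
pose E := (expR (Num.max K1 K2 - Num.min c1 c2 * n%:R))%:E * L n w phi0.
have step K c : (K <= Num.max K1 K2)%R -> (Num.min c1 c2 <= c)%R ->
    (expR (K - c * n%:R))%:E * L n w phi0 <= E.
  move=> hK hc; apply: lee_wpmul2r; first exact: likelihood_ge0.
  by rewrite lee_fin ler_expR lerB// ler_wpM2r.
apply: (@le_trans _ _ (E + E)).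
  rewrite (_ : F `|` G = F `|` (G `\` F)); last by rewrite setUDr setDv setD0.
  rewrite ge0_integral_setU//; last 3 first.
  - exact: measurableD.
  - by move=> phi _; exact: likelihood_ge0.
  - by apply/disj_setPS => x [Fx []].
  apply: leeD.
    by apply: le_trans (h1 n) _; apply: step; rewrite ?le_max ?ge_min lexx.
  apply: (@le_trans _ _ (\int[Q]_(phi in G) L n w phi)).
    by apply: ge0_subset_integral => //; [exact: measurableD|exact: L0].
  by apply: le_trans (h2 n) _; apply: step; rewrite ?le_max ?ge_min lexx orbT.
rewrite addrAC expRD EFinM muleAC -/E.
rewrite -mule2n -mule_natl muleC; apply: lee_wpmul2l.
  by rewrite mule_ge0 ?lee_fin ?expR_ge0// likelihood_ge0.
rewrite lee_fin; apply: le_trans (expR_ge1Dx 1); lra.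
Qed.

(** The sums of [W] over the sample grow at least like [c n - K], and they bound the log-likelihood
    ratio from below at almost every point of [F]; integrating over [F] costs a factor
    [Q F <= 1]. *)
Lemma exp_small_essential (F : set Phi) (W : T -> \bar R) :
  measurable F -> measurable_fun setT W -> 0 < \int[nu]_x W x ->
  (forall x, {ae Q, forall phi, F phi -> W x <= lne (a x phi0 / a x phi)}) ->
  exp_small F.
Proof.
move=> mF mW W0 WF.
have [c c0 h] := iid_linear_lower_bound iidP mW W0.
exists c => //; apply: ae_imp2 h (ae_all_coordinates iidP a_pos).
move=> w [y [K [yW yK]]] wpos; exists K => n.
set b := (expR (K - c * n%:R))%:E * L n w phi0.
have b0 : 0 <= b by rewrite mule_ge0 ?lee_fin ?expR_ge0// likelihood_ge0.
apply: (@le_trans _ _ (\int[Q]_(phi in F) cst b phi)).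
  apply: ae_ge0_le_integral => //.
  - by move=> phi _; exact: likelihood_ge0.
  - by apply: measurable_funTS; exact: measurable_likelihood_at.
  (* The exceptional set of parameters depends on [w j]; for a fixed sample there are countably many
     of them. *)
  have /ae_foralln : forall j,
      {ae Q, forall phi, F phi -> W (w j) <= lne (a (w j) phi0 / a (w j) phi)}.
    by move=> j; exact: WF.
  apply: filterS => phi h Fphi.
  apply: (@le_trans _ _ ((expR (\sum_(j < n) - y j))%:E * L n w phi0)).
    apply: (@likelihood_factor_le n w (fun j => - y j)%R) => j _.
    apply: lne_ratio_ge => //; apply: le_trans (yW j) _; exact: h.
  apply: lee_wpmul2r; first exact: likelihood_ge0.
  by rewrite lee_fin ler_expR sumrN lerNl opprB yK.
rewrite integral_cst// -[leRHS]mule1; apply: lee_wpmul2l => //.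
exact: probability_le1.
Qed.

(* The first hypothesis cannot be dropped: +oo - +oo = -oo in the extended reals,
   so the second one does not by itself make the log-ratio integrable. *)
Lemma likelihood_lower_bound (delta : R) phi :
  \int[nu]_x (fun x => lne (a x phi0 / a x phi))^\- x < +oo ->
  \int[nu]_x lne (a x phi0 / a x phi) < delta%:E ->
  {ae P, forall w : nat -> T, exists k : nat, forall n,
    (expR (- k%:R - delta * n%:R))%:E * L n w phi0 <= L n w phi}.
Proof.
set X := fun x => lne (a x phi0 / a x phi) => Xneg Xd.
have max phi' : measurable_fun setT (a ^~ phi').
  exact: (measurableT_comp ma (@measurable_pair2 _ _ _ _ phi')).
have mX : measurable_fun setT X.
  by apply: measurable_fun_lne; exact: measurable_fun_dive.
have Xpos : \int[nu]_x X^\+ x < +oo.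
  rewrite ltey; apply/eqP => Xoo; move: Xd; rewrite integralE Xoo.
  have : \int[nu]_x X^\- x \is a fin_num by rewrite ge0_fin_numE ?integral_ge0.
  by move=> /fineK <-.
have iX : nu.-integrable setT X.
  apply/integrableP; split => //; under eq_integral do rewrite -/((abse \o X) _) fune_abse.
  rewrite ge0_integralD//; [|exact: measurable_funepos|exact: measurable_funeneg].
  exact: lte_add_pinfty.
pose W x := delta%:E - X x.
have mW : measurable_fun setT W by exact: emeasurable_funB.
have W0 : 0 < \int[nu]_x W x.
  rewrite integralB//; last exact: finite_measure_integrable_cst.
  by rewrite integral_cst_probability sube_gt0.
have [c c0 h] := iid_linear_lower_bound iidP mW W0.
apply: ae_imp2 h (ae_all_coordinates iidP a_pos).
(* An integer above [|K|]: integer constants make the union over [k] in the next lemma countable. *)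
move=> w [y [K [yW yK]]] wpos; exists (Num.truncn `|K|%R).+1 => n.
apply: (@le_trans _ _ ((expR (\sum_(j < n) - (delta - y j)))%:E * L n w phi0)).
  apply: lee_wpmul2r; first exact: likelihood_ge0.
  rewrite lee_fin ler_expR sumrN sumrB sumr_const card_ord -mulr_natr.
  have := truncnS_gt `|K|%R; have := ler_norm K; have := yK n.
  have : (0 <= c * n%:R)%R by rewrite mulr_ge0// ltW.
  lra.
apply: (@likelihood_factor_ge n w (fun j => - (delta - y j))%R) => j _.
apply: lne_ratio_le => //; rewrite -/(X (w j)).
have := yW j; rewrite /W; case: (X (w j)) => [r||] //=; last by rewrite leNye.
by rewrite -EFinB !lee_fin; lra.
Qed.

(** The exceptional set of samples depends on [phi]. Tonelli exchanges the quantifiers: for almost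
    every sample, almost all of [D] is covered by the sections of the [E k], so one of these meets
    [D] in positive mass, and integrating over it suffices. *)
Lemma evidence_lower_bound (delta : R) (D : set Phi) :
  measurable D -> 0 < Q D ->
  (forall phi, D phi -> {ae P, forall w : nat -> T, exists k : nat, forall n,
    (expR (- k%:R - delta * n%:R))%:E * L n w phi0 <= L n w phi}) ->
  {ae P, forall w : nat -> T, exists K : R, forall n,
    (expR (K - delta * n%:R))%:E * L n w phi0 <= \int[Q]_phi L n w phi}.
Proof.
move=> mD QD hD.
pose E k := [set z : sequence_space T * Phi | forall n,
  (expR (- k%:R - delta * n%:R))%:E * L n z.1 phi0 <= L n z.1 z.2].
have mE k : measurable (E k).
  rewrite (_ : E k = \bigcap_n (setT `&` [set z : sequence_space T * Phi |
      (expR (- k%:R - delta * n%:R))%:E * L n z.1 phi0 <= L n z.1 z.2])); last first.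
    by apply/seteqP; split => z h n; [split => //; exact: h|have [] := h n I].
  apply: bigcap_measurableType => // n _; apply: measurable_lee => //; last first.
    exact: measurable_likelihood.
  apply: measurable_funeM.
  apply: (@measurableT_comp _ _ _ _ _ _ (fun w : sequence_space T => L n w phi0)) => //.
  exact: (measurableT_comp (measurable_likelihood n) (@measurable_pair2 _ _ _ _ phi0)).
(* The pairs with parameter in [D] for which no constant works. *)
pose B := (setT `*` D) `\` \bigcup_k E k.
have mB : measurable B.
  apply: measurableD; first exact: measurableX.
  by apply: bigcup_measurable => k _; exact: mE.
have B0 phi : P (ysection B phi) = 0.
  apply/negligibleP; first exact: measurable_ysection.
  have [Dphi|nD] := pselect (D phi); last first.
    rewrite (_ : ysection B phi = set0); first exact: negligible_set0.
    by apply/seteqP; split => // w; rewrite /ysection /= inE => -[[_ ]].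
  apply: negligibleS (hD _ Dphi) => w; rewrite /ysection /= inE => -[_ nE] /= [k h].
  by apply: nE; exists k.
have := ae_null_xsection Q mB B0; apply: (@ae_imp _ (sequence_space T)) => w QB.
have mEw k : measurable (D `&` xsection (E k) w).
  by apply: measurableI => //; exact: measurable_xsection.
have [k kpos] : exists k, 0 < Q (D `&` xsection (E k) w).
  apply: contrapT => /forallNP h.
  suff : Q.-negligible D by move=> /(negligibleP _ mD) D0; move: QD; rewrite D0 ltxx.
  apply: (@negligibleS _ _ _ _ (xsection B w `|` \bigcup_k (D `&` xsection (E k) w))).
    move=> phi Dphi; have [[k Ek]|nE] := pselect (exists k, E k (w, phi)).
      by right; exists k => //; split => //; rewrite /xsection /= inE.
    by left; rewrite /xsection /= inE; split => // -[k _ Ek]; apply: nE; exists k.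
  apply: negligibleU.
    by apply/(negligibleP _ (measurable_xsection w mB)).
  apply: negligible_bigcup => k; apply/(negligibleP _ (mEw k)).
  by apply/eqP; rewrite eq_le measure_ge0 andbT leNgt; apply/negP; exact: h.
set q := Q _ in kpos.
have qfin : q \is a fin_num by exact: fin_num_measure.
have fq : (0 < fine q)%R by rewrite fine_gt0// kpos ltey_eq qfin.
(* The mass [q] of the chosen section enters the exponent as its logarithm. *)
exists (ln (fine q) - k%:R)%R => n.
have mL (S : set Phi) : measurable_fun S (L n w).
  by apply: measurable_funTS; exact: measurable_likelihood_at.
apply: (@le_trans _ _ (\int[Q]_(phi in D `&` xsection (E k) w) L n w phi)); last first.
  apply: ge0_subset_integral => //.
  by move=> phi _; exact: likelihood_ge0.
rewrite -addrA expRD lnK ?posrE// EFinM fineK// -muleA muleC.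
rewrite -integral_cst//; apply: ge0_le_integral => //.
- by move=> phi _; rewrite mule_ge0 ?lee_fin ?expR_ge0// likelihood_ge0.
- by move=> phi [_]; rewrite /xsection /= inE => /(_ n).
Qed.

(** By Tonelli, the [P]-mean of the [Q]-integral of the likelihood ratio against [phi0] is at most
    1, so this integral is almost surely finite. It guards the posterior against an infinite
    denominator. *)
Lemma evidence_finite :
  (forall phi, \int[nu]_x (a x phi / a x phi0) <= 1) ->
  {ae P, forall w : nat -> T, forall n, \int[Q]_phi L n w phi < +oo}.
Proof.
move=> r1; pose r x phi := a x phi / a x phi0.
have r0 x phi : 0 <= r x phi by rewrite mule_ge0// inve_ge0.
have max phi : measurable_fun setT (a ^~ phi).
  exact: (measurableT_comp ma (@measurable_pair2 _ _ _ _ phi)).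
have mr : measurable_fun setT (fun z : T * Phi => r z.1 z.2).
  apply: measurable_fun_dive => //.
  exact: (measurableT_comp (max phi0)).
have mrphi phi : measurable_fun setT (r ^~ phi) by exact: measurable_fun_dive.
pose f n (z : sequence_space T * Phi) := \prod_(j < n) r ((z.1 : nat -> T) j) z.2.
have f0 n z : 0 <= f n z by exact: prode_ge0.
have mf n : measurable_fun setT (f n).
  apply: (@measurable_fun_prode _ _ _ n (fun j (z : sequence_space T * Phi) =>
    r ((z.1 : nat -> T) j) z.2)) => j.
  exact: (measurableT_comp mr (measurable_observation j)).
have fin n : {ae P, forall w, \int[Q]_phi f n (w, phi) < +oo}.
  have mF : measurable_fun setT (fubini_F Q (f n)).
    by apply: measurable_fun_fubini_tonelli_F => //; exact: mf.
  have F0 w : 0 <= fubini_F Q (f n) w by exact: integral_ge0.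
  have iF : P.-integrable setT (fubini_F Q (f n)).
    apply/integrableP; split => //; under eq_integral do rewrite gee0_abs//.
    rewrite [ltLHS](fubini_tonelli _ (mf n) (f0 n)).
    apply: (@le_lt_trans _ _ (\int[Q]_phi cst 1 phi)).
      apply: ge0_le_integral => //.
      - by move=> phi _; exact: integral_ge0.
      - by apply: (@measurable_fun_fubini_tonelli_G _ _ _ _ _ P (f n)); [exact: mf|exact: f0].
      - move=> phi _; exact: (integral_prod_coordinates_le1 n iidP (mrphi phi)
          (fun x => r0 x phi) (r1 phi)).
    by rewrite integral_cst_probability ltry.
  apply: ae_imp (integrable_ae measurableT iF) => w /(_ I).
  by rewrite ge0_fin_numE.
have := ae_foralln fin; move=> h.
apply: ae_imp2 h (ae_all_coordinates iidP a_pos) => w wfin wpos n.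
have /andP[A0 Afin] := likelihood_phi0_gt0 n wpos.
have LE phi : L n w phi = L n w phi0 * f n (w, phi).
  rewrite /L /f /= -big_split /=; apply: eq_bigr => j _.
  have /andP[p0] := wpos j; rewrite /r; move: p0.
  case: (a (w j) phi0) => [s||]; rewrite ?ltxx// lte_fin => s0 _.
  by rewrite inver gt_eqF// muleCA -EFinM divff ?gt_eqF// mule1.
under eq_integral do rewrite LE.
rewrite ge0_integralZl//; last 2 first.
- exact: (measurableT_comp (mf n) (@measurable_pair1 _ _ _ _ w)).
- exact: ltW.
by rewrite lte_mul_pinfty// ?ltW// ge0_fin_numE// ltW.
Qed.

End posterior_concentration.

(** The defect from 1 is [t / (s + t)], at most [expR (K1 - K2)] times the [n]-th power of
    [expR (delta - c) < 1]. Positivity of [A] and finiteness of [s + t] turn the quotient into one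
    of real numbers. *)
Lemma ratio_cvg1 (R : realType) (s t A : nat -> \bar R) (c delta K1 K2 : R) :
  (delta < c)%R -> (forall n, 0 <= s n) -> (forall n, 0 <= t n) ->
  (forall n, 0 < A n < +oo) -> (forall n, s n + t n < +oo) ->
  (forall n, t n <= (expR (K1 - c * n%:R))%:E * A n) ->
  (forall n, (expR (K2 - delta * n%:R))%:E * A n <= s n + t n) ->
  (s n / (s n + t n)) @[n --> \oo] --> 1.
Proof.
move=> dc s0 t0 A0 stoo tA Ast.
pose x n : R := (expR (K1 - K2) * expR (delta - c) ^+ n)%R.
have key n : exists2 u : R, s n / (s n + t n) = u%:E & (1 - x n <= u <= 1)%R.
  move: (s0 n) (t0 n) (A0 n) (stoo n) (tA n) (Ast n).
  case: (s n) => [a|_|//]; last first.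
    by case: (t n) => [b||//] _ _; rewrite addye//.
  case: (t n) => [b|_ _ _|//]; last by rewrite addey//.
  case: (A n) => [g||]; rewrite ?ltxx ?andbF//.
  rewrite -!EFinM -EFinD !lee_fin !lte_fin => a0 b0 /andP[g0 _] _ hb hab.
  have ab0 : (0 < a + b)%R by apply: lt_le_trans hab; rewrite mulr_gt0// expR_gt0.
  exists (a / (a + b))%R; first by rewrite inver gt_eqF.
  have -> : (a / (a + b) = 1 - b / (a + b))%R.
    by rewrite -[in X in (X - _)%R](divff (lt0r_neq0 ab0)) -mulrBl addrK.
  apply/andP; split; last by rewrite gerBl divr_ge0// ltW.
  rewrite lerB// ler_pdivrMr//; apply: le_trans hb _.
  have -> : expR (K1 - c * n%:R) = (x n * expR (K2 - delta * n%:R))%R.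
    rewrite /x -expRM_natr -!expRD; congr expR; lra.
  rewrite -mulrA ler_wpM2l// mulr_ge0 ?expR_ge0// exprn_ge0// expR_ge0.
have [u uE /all_and2[lu ul]] : exists2 u : nat -> R,
    (forall n, s n / (s n + t n) = (u n)%:E) & (forall n, 1 - x n <= u n /\ u n <= 1)%R.
  have /choice[u hu] : forall n, exists u : R,
      s n / (s n + t n) = u%:E /\ (1 - x n <= u <= 1)%R.
    by move=> n; have [u h1 h2] := key n; exists u.
  by exists u => n; have [? /andP[]] := hu n.
under eq_fun do rewrite uE.
apply: cvg_EFin; first by near=> n.
apply: (@squeeze_cvgr _ _ _ _ (fun n => 1 - x n)%R (cst 1%R)); last exact: cvg_cst.
  by near=> n; rewrite lu ul.
rewrite -[X in _ --> X]subr0; apply: cvgB; first exact: cvg_cst.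
rewrite -[X in _ --> X](mulr0 (expR (K1 - K2))); apply: cvgMr.
apply: cvg_expr; rewrite ger0_norm ?expR_ge0// -expR0 ltr_expR; lra.
Unshelve. all: by end_near. Qed.

(** Stated without measurability, for the sake of the infimum of log-ratios over a neighbourhood.
    The integral of a nonnegative function is a supremum over simple functions below it, hence
    monotone; positive and negative parts give the general case. *)
Lemma integral_gt0_le d (T : measurableType d) (R : realType)
    (mu : {measure set T -> \bar R}) (Z W : T -> \bar R) :
  (forall x, Z x <= W x) -> 0 < \int[mu]_x Z x -> 0 < \int[mu]_x W x.
Proof.
move=> ZW /lt_le_trans; apply.
have mono (f g : T -> \bar R) : (forall x, 0 <= f x) -> (forall x, f x <= g x) ->
    \int[mu]_x f x <= \int[mu]_x g x.
  move=> f0 fg; have g0 x : 0 <= g x by apply: le_trans (fg x).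
  rewrite !ge0_integralTE//; apply: le_ereal_sup => _ [h hf <-].
  by exists h => // x; apply: le_trans (fg x); exact: hf.
rewrite [leLHS]integralE [leRHS]integralE; apply: leeB; apply: mono => // x.
- rewrite !funeposE ge_max !le_max lexx ZW orbT//.
- by rewrite !funenegE ge_max !le_max lexx leeN2 ZW orbT.
Qed.

(** The map [(Pi, phi) |-> Pi] is a probability kernel, against which a jointly measurable
    nonnegative function is integrated. *)
Lemma measurable_avg_density (R : realType) d d' (Theta : measurableType d)
    (Phi : measurableType d') (p : Phi -> Theta -> R) :
  measurable_fun setT (fun x : Phi * Theta => p x.1 x.2) ->
  (forall phi theta, 0 <= p phi theta)%R ->
  measurable_fun setT
    (fun z : pprobability Theta R * Phi => avg_density p z.1 z.2).
Proof.
move=> mp p0.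
pose fst_ (z : pprobability Theta R * Phi) : pprobability Theta R := z.1.
have mfst : measurable_fun setT fst_ by exact: measurable_fst.
apply: (@measurable_fun_integral_sfinite_kernel _ _ _ _ _
  (fun zt : (pprobability Theta R * Phi) * Theta => (p zt.1.2 zt.2)%:E)
  (kprobability mfst)).
- by move=> zt; rewrite lee_fin.
- apply/measurable_EFinP.
  have mg : measurable_fun setT
      (fun zt : (pprobability Theta R * Phi) * Theta => (zt.1.2, zt.2)).
    by apply: measurable_fun_pair => //; exact: (measurableT_comp measurable_snd measurable_fst).
  exact: (measurableT_comp mp mg).
Qed.

(** * The model of distributional observations *)

Section superposterior.
Context (R : realType) (d : measure_display) (Theta : measurableType d).
Variables (mu : {measure set Theta -> \bar R}) (Phi : pmetricType R).
Variables (Q : probability (borel Phi) R) (p : borel Phi -> Theta -> R).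
Variables (kappa : {measure set (pprobability Theta R) -> \bar R}).
Variables (C : nat -> R) (H : nat -> Phi -> probability (pprobability Theta R) R).
Variable phi0 : Phi.
Hypothesis p_density : density_family mu p.
Hypothesis H_density : forall j phi,
  has_density kappa (H j phi) (fun Pi => obs_density p C j Pi phi).

Local Notation T := (pprobability Theta R).
Local Notation nu := (H 0%N phi0).
Local Notation a := (avg_density p).
Local Notation h := (fun phi Pi => obs_density p C 0 Pi phi).

Let ma : measurable_fun setT (fun z : T * borel Phi => a z.1 z.2).
Proof. by case: p_density => mp p0 _; exact: measurable_avg_density. Qed.

Let a_ge0 (Pi : T) (phi : borel Phi) : 0 <= a Pi phi.
Proof. by case: p_density => _ p0 _; apply: integral_ge0 => t _; rewrite lee_fin. Qed.

Let maphi (phi : borel Phi) : measurable_fun setT (fun Pi : T => a Pi phi).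
Proof. exact: (measurableT_comp ma (@measurable_pair2 _ _ _ _ phi)). Qed.

(* Each H j phi0 has mass 1, so every C j is the inverse of the integral of
   avg_density against kappa. *)
Lemma normalizer_spec j : (0 < C j)%R /\ C j = C 0%N.
Proof.
pose I := \int[kappa]_Pi a Pi phi0.
have I0 : 0 <= I by apply: integral_ge0 => Pi _; exact: a_ge0.
have CI k : (0 < C k)%R /\ (C k)%:E * I = 1.
  have /= := H_density k phi0 measurableT.
  rewrite [LHS]probability_setT /obs_density => e.
  have Ck0 : (0 <= C k)%R.
    rewrite leNgt; apply/negP => Ck.
    (* A negative constant would make a nonpositive function have integral 1. *)
    have : 0 < \int[kappa]_Pi (cst 0 : T -> \bar R) Pi.
      apply: (@integral_gt0_le _ _ _ _ (fun Pi => (C k)%:E * a Pi phi0)).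
        by move=> Pi; rewrite mule_le0_ge0// lee_fin ltW.
      by rewrite -e lte01.
    by rewrite integral0 ltxx.
  have {}e : (C k)%:E * I = 1 by rewrite e ge0_integralZl_EFin.
  split => //; rewrite lt_neqAle Ck0 andbT; apply/eqP => Ck.
  by move/eqP: e; rewrite -Ck mul0e eq_sym onee_eq0.
move: I0 (CI j) (CI 0%N); rewrite {CI}; case: I => [r _|_ [Cj0]|//].
  rewrite -!EFinM => -[Cj0 [rI]] [_ [oI]]; split => //.
  apply: (@mulIf _ r); last by rewrite rI oI.
  by apply/eqP => r0; move: rI; rewrite r0 mulr0 => /eqP; rewrite eq_sym oner_eq0.
by rewrite gt0_muley.
Qed.

Let C0_gt0 : (0 < C 0%N)%R. Proof. by case: (normalizer_spec 0). Qed.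

Let h_density phi : has_density kappa (H 0%N phi) (h phi).
Proof. exact: H_density. Qed.

Let mh phi : measurable_fun setT (h phi).
Proof. exact: measurable_funeM. Qed.

Let h_ge0 phi Pi : 0 <= h phi Pi.
Proof. by rewrite mule_ge0// lee_fin ltW. Qed.

Lemma observation_distribution j phi A : measurable A -> H j phi A = H 0%N phi A.
Proof.
move=> mA; rewrite (H_density j phi mA) (H_density 0 phi mA).
by apply: eq_integral => Pi _; rewrite /obs_density (normalizer_spec j).2.
Qed.

Lemma obs_density_ratio j Pi phi psi :
  obs_density p C j Pi phi / obs_density p C j Pi psi = a Pi phi / a Pi psi.
Proof. by rewrite /obs_density dive_scale//; case: (normalizer_spec j). Qed.

Lemma avg_density_pos : {ae nu, forall Pi, 0 < a Pi phi0 < +oo}.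
Proof.
have := density_pos_ae (mh phi0) (h_ge0 phi0) (h_density phi0).
apply: ae_imp => Pi; rewrite /obs_density; move: (a_ge0 Pi phi0).
case: (a Pi phi0) => [r||]; rewrite ?gt0_muley ?lte_fin ?ltxx ?andbF//.
by rewrite -EFinM ?lte_fin pmulr_rgt0// !ltry.
Qed.

Lemma integral_inverse_avg_ratio_le1 phi : \int[nu]_Pi (a Pi phi / a Pi phi0) <= 1.
Proof.
have := integral_inverse_ratio_le1 (mh phi0) (h_ge0 phi0) (mh phi) (h_ge0 phi)
  (h_density phi0) (h_density phi).
by under eq_integral do rewrite obs_density_ratio.
Qed.

Let X phi (Pi : T) := lne (a Pi phi0 / a Pi phi).

Lemma integral_log_avg_ratio_neg_le1 phi : \int[nu]_Pi (X phi)^\- Pi <= 1.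
Proof.
have := integral_log_ratio_neg_le1 (mh phi0) (h_ge0 phi0) (mh phi) (h_ge0 phi)
  (h_density phi0) (h_density phi).
rewrite (_ : (fun Pi : T => lne (h phi0 Pi / h phi Pi)) = X phi)//.
by apply/funext => Pi; rewrite obs_density_ratio.
Qed.

Let mX : measurable_fun setT (fun z : T * borel Phi => X z.2 z.1).
Proof.
apply: measurable_fun_lne; apply: measurable_fun_dive => //.
exact: (measurableT_comp (maphi phi0) measurable_fst).
Qed.

Lemma KL_observation j phi : KL (H j phi0) (H j phi) = \int[nu]_Pi X phi Pi.
Proof.
have hj psi : measurable_fun setT (fun Pi : T => obs_density p C j Pi psi).
  exact: measurable_funeM.
have hj0 psi Pi : 0 <= obs_density p C j Pi psi.
  by rewrite mule_ge0// lee_fin ltW//; case: (normalizer_spec j).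
rewrite (KL_log_ratio (hj phi0) (hj0 phi0) (hj phi) (hj0 phi)
  (H_density j phi0) (H_density j phi)).
under eq_integral do rewrite obs_density_ratio.
by apply: eq_measure_integral => A mA _; exact: observation_distribution.
Qed.

Lemma avgKL_observation n phi : (0 < n)%N ->
  avgKL H n phi0 phi = \int[nu]_Pi X phi Pi.
Proof.
move=> n0; rewrite /avgKL; under eq_bigr do rewrite KL_observation.
set k := \int[nu]_Pi _.
have -> : \sum_(j < n) k = n%:R%:E * k.
  elim: n {n0} => [|n ih]; first by rewrite big_ord0 mul0e.
  rewrite big_ord_recr /= ih -[n.+1]addn1 natrD EFinD.
  by rewrite ge0_muleDl ?lee_fin ?ler0n// mul1e.
by rewrite muleA -EFinM mulVf ?mul1e// pnatr_eq0 -lt0n.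
Qed.

Lemma KLball_observation eps :
  KLball H eps phi0 = [set phi | \int[nu]_Pi X phi Pi < eps%:E].
Proof.
apply/seteqP; split => phi /=.
  by move=> /(_ 1%N isT); rewrite /KLball_n /= avgKL_observation.
by move=> h n /= n0; rewrite /KLball_n /= avgKL_observation.
Qed.

(** The ball is a sublevel set of the mean log-ratio, whose positive and negative parts are
    measurable in [phi] by Tonelli. *)
Lemma measurable_KLball eps : measurable (KLball H eps phi0 : set (borel Phi)).
Proof.
rewrite KLball_observation -[X in measurable X]setTI.
apply: measurable_lte => //.
under eq_fun do rewrite integralE.
apply: emeasurable_funB.
  apply: (@measurable_fun_fubini_tonelli_G _ _ _ _ _ nu (fun z : T * borel Phi => (X z.2)^\+ z.1)).
    rewrite (_ : (fun z : T * borel Phi => (X z.2)^\+ z.1) = (fun z => X z.2 z.1)^\+).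
      exact: measurable_funepos.
    by apply/funext => z; rewrite !funeposE.
  by move=> z; exact: funepos_ge0.
apply: (@measurable_fun_fubini_tonelli_G _ _ _ _ _ nu (fun z : T * borel Phi => (X z.2)^\- z.1)).
  rewrite (_ : (fun z : T * borel Phi => (X z.2)^\- z.1) = (fun z => X z.2 z.1)^\-).
    exact: measurable_funeneg.
  by apply/funext => z; rewrite !funenegE.
by move=> z; exact: funeneg_ge0.
Qed.

Lemma KLball_center eps : (0 < eps)%R -> KLball H eps phi0 phi0.
Proof.
move=> eps0; rewrite KLball_observation /=.
rewrite (@ae_eq_integral _ _ _ nu setT (cst 0))//; first by rewrite integral0 lte_fin.
- by apply: measurable_fun_lne; exact: measurable_fun_dive.
- apply: ae_imp avg_density_pos => Pi + _; rewrite /X.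
  case: (a Pi phi0) => [r||]; rewrite ?ltxx ?andbF// lte_fin => /andP[r0 _].
  by rewrite inver gt_eqF// -EFinM divff ?gt_eqF// lne1.
Qed.

(** The essential infimum over [N] is measurable and lies above the infimum, so it inherits the
    positive mean. *)
Lemma exp_small_neighborhood (P : probability (sequence_space T) R) (N : set Phi) :
  is_product_probability (fun=> nu) P -> open N ->
  0 < \int[nu]_Pi inf_logratio p C phi0 0 N Pi ->
  exp_small P Q (avg_density p) phi0 (N : set (borel Phi)).
Proof.
move=> iidP oN ZN.
have mN : measurable (N : set (borel Phi)) by exact: sub_sigma_algebra.
have [W [mW ZW WN]] := measurable_ess_inf_bound Q (l := fun Pi phi => X phi Pi) mN mX.
apply: (exp_small_essential iidP ma a_ge0 avg_density_pos mN mW _ WN).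
apply: integral_gt0_le ZN => Pi; apply: le_trans (ZW Pi).
rewrite /inf_logratio; under eq_imagel do rewrite obs_density_ratio.
exact: lexx.
Qed.

Lemma exp_small_complement (P : probability (sequence_space T) R) (F : set Phi) :
  is_product_probability (fun=> nu) P -> compact [set: Phi] -> closed F ->
  ~ F phi0 ->
  (forall phi : Phi, phi <> phi0 -> exists N : set Phi, [/\ open N, N phi &
     0 < \int[nu]_Pi inf_logratio p C phi0 0 N Pi]) ->
  exp_small P Q (avg_density p) phi0 (F : set (borel Phi)).
Proof.
move=> iidP cPhi cF Fphi0 hN.
have /choice[V hV] : forall phi : Phi, exists N : set Phi, [/\ open N,
    phi <> phi0 -> N phi & exp_small P Q (avg_density p) phi0 (N : set (borel Phi))].
  move=> phi; have [->|/eqP/hN[N [oN Nphi ZN]]] := eqVneq phi phi0.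
    (* The point [phi0] is outside [F], so it needs no neighbourhood in the cover. *)
    by exists set0; split => //; [exact: open0|exact: exp_small_set0].
  by exists N; split => //; exact: exp_small_neighborhood.
have mV phi : measurable (V phi : set (borel Phi)).
  by apply: sub_sigma_algebra; have [] := hV phi.
have mF : measurable (F : set (borel Phi)).
  rewrite -[F]setCK; apply: measurableC; apply: sub_sigma_algebra.
  exact: closed_openC.
have : compact F by exact: (subclosed_compact cF cPhi).
rewrite compact_cover => /(_ Phi setT V) [].
- by move=> phi _; have [] := hV phi.
- move=> phi Fphi; exists phi => //; have [_ Ophi _] := hV phi; apply: Ophi.
  by move=> e; apply: Fphi0; rewrite -e.
move=> D _ FD.
pose U (s : seq Phi) : set (borel Phi) := \big[setU/set0]_(phi <- s) V phi.
have sU s : measurable (U s) /\ exp_small P Q (avg_density p) phi0 (U s).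
  elim: s => [|phi s [ms es]]; rewrite /U.
    by rewrite big_nil; split => //; exact: exp_small_set0.
  rewrite big_cons; split; first exact: measurableU.
  by apply: exp_smallU => //; have [] := hV phi.
have [mU eU] := sU (finmap.enum_fset D).
apply: (exp_smallS ma a_ge0 mF mU _ eU) => phi /FD [psi /= Dpsi Opsi].
rewrite /U -bigcup_seq; exists psi => //.
Qed.

End superposterior.

(** * Concentration of the superposterior on the open set *)

Theorem theoremB3 (R : realType) (d : measure_display)
    (Theta : measurableType d) (mu : {measure set Theta -> \bar R})
    (Phi : pmetricType R) (Q : probability (borel Phi) R)
    (p : borel Phi -> Theta -> R)
    (kappa : {measure set (pprobability Theta R) -> \bar R})
    (C : nat -> R)
    (H : nat -> Phi -> probability (pprobability Theta R) R)
    (phi0 : Phi)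
    (Hprod : probability (sequence_space (pprobability Theta R)) R) :
  borel_space R Theta ->
  density_family mu p ->
  (forall j phi,
     has_density kappa (H j phi) (fun Pi => obs_density p C j Pi phi)) ->
  is_product_probability (fun j => H j phi0) Hprod ->
  compact [set: Phi] ->
  (forall eps : R, (0 < eps)%R -> 0 < Q (KLball H eps phi0)) ->
  (forall phi : Phi, phi <> phi0 ->
     exists N : set Phi, [/\ open N, N phi &
       0 < ereal_inf [set \int[H j phi0]_Pi inf_logratio p C phi0 j N Pi | j in setT]]) ->
  forall (eps : R) (C0 : set Phi), (0 < eps)%R -> open C0 ->
    KLball H eps phi0 `<=` C0 ->
    {ae Hprod, forall Pis : nat -> pprobability Theta R,
       superposterior p Q J Pis C0 @[J --> \oo] --> 1}.
Proof.
move=> _ pD hD prodP cPhi QK hN eps C0 eps0 oC0 KC0.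
have iidP : is_product_probability (fun=> H 0%N phi0) Hprod.
  move=> n A mA; rewrite (prodP n A mA); apply: eq_bigr => j _.
  exact: (observation_distribution phi0 pD hD).
have ma : measurable_fun setT
    (fun z : pprobability Theta R * borel Phi => avg_density p z.1 z.2).
  by case: pD => mp p0 _; exact: measurable_avg_density.
have a_ge0 (Pi : pprobability Theta R) (phi : borel Phi) : 0 <= avg_density p Pi phi.
  by case: pD => _ p0 _; apply: integral_ge0 => t _; rewrite lee_fin.
have apos := avg_density_pos phi0 pD hD.
have mC0 : measurable (C0 : set (borel Phi)) by exact: sub_sigma_algebra.
have mF : measurable (~` C0 : set (borel Phi)) by exact: measurableC.
have [c c0 Fsmall] : exp_small Hprod Q (avg_density p) phi0 (~` C0 : set (borel Phi)).
  apply: (exp_small_complement Q pD hD iidP cPhi).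
  - exact: open_closedC.
  (* [C0] contains the ball of radius [eps], and hence its centre [phi0]. *)
  - by apply; apply: KC0; exact: (KLball_center phi0 pD hD eps0).
  - move=> phi /hN[N [oN Nphi ZN]]; exists N; split => //.
    (* The infimum over [j] is below its term at index 0, and every observation has the law of the
       first. *)
    by apply: lt_le_trans ZN _; apply: ereal_inf_lbound; exists 0%N.
(* The rate of the denominator must be below the rate [c] of the numerator; the ball of radius
   [c / 2] has positive prior mass. *)
have c20 : (0 < c / 2)%R by rewrite divr_gt0.
have evidence_ge : {ae Hprod, forall w : nat -> pprobability Theta R,
    exists K : R, forall n,
    (expR (K - c / 2 * n%:R))%:E * likelihood (avg_density p) n w phi0
      <= \int[Q]_phi likelihood (avg_density p) n w phi}.
  apply: (evidence_lower_bound ma a_ge0 (measurable_KLball phi0 pD hD (c / 2))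
    (QK _ c20)) => phi Kphi.
  apply: (likelihood_lower_bound iidP ma a_ge0 apos).
    by apply: le_lt_trans (integral_log_avg_ratio_neg_le1 phi0 pD hD phi) _; rewrite ltry.
  by move: Kphi; rewrite (KLball_observation phi0 pD hD).
have evidence_fin := evidence_finite Q iidP ma a_ge0 apos
  (integral_inverse_avg_ratio_le1 phi0 pD hD).
have coord_pos := ae_all_coordinates iidP apos.
have {}evidence_fin : {ae Hprod, forall w : nat -> pprobability Theta R,
    (forall n, \int[Q]_phi likelihood (avg_density p) n w phi < +oo) /\
    (forall j, 0 < avg_density p (w j) phi0 < +oo)}.
  by move: evidence_fin coord_pos; apply: (@ae_imp2 _ (sequence_space _)).
have {Fsmall evidence_ge} bounds : {ae Hprod, forall w : nat -> pprobability Theta R,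
    (exists K : R, forall n, \int[Q]_(phi in ~` C0) likelihood (avg_density p) n w phi
       <= (expR (K - c * n%:R))%:E * likelihood (avg_density p) n w phi0) /\
    (exists K : R, forall n,
       (expR (K - c / 2 * n%:R))%:E * likelihood (avg_density p) n w phi0
         <= \int[Q]_phi likelihood (avg_density p) n w phi)}.
  by move: Fsmall evidence_ge; apply: (@ae_imp2 _ (sequence_space _)).
move: bounds evidence_fin; apply: (@ae_imp2 _ (sequence_space _)).
move=> w [[K1 num] [K2 den]] [fin pos].
pose L n := likelihood (avg_density p) n w.
(* The denominator is the integral over [C0] plus the exponentially small one over its complement,
   as in [ratio_cvg1]. *)
have splitE n : \int[Q]_phi L n phi
    = \int[Q]_(phi in C0) L n phi + \int[Q]_(phi in ~` C0) L n phi.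
  rewrite -[X in integral _ X](setUv C0) ge0_integral_setU//.
  - by rewrite setUv; exact: (measurable_likelihood_at ma).
  - by move=> phi _; exact: likelihood_ge0.
  - by apply/disj_setPS => phi [].
have L_ge0 n phi : 0 <= L n phi by exact: likelihood_ge0.
rewrite (_ : (fun J => superposterior p Q J w C0) =
    (fun n => (\int[Q]_(phi in C0) L n phi) /
      (\int[Q]_(phi in C0) L n phi + \int[Q]_(phi in ~` C0) L n phi))); last first.
  by apply/funext => n; rewrite -splitE.
apply: (@ratio_cvg1 R _ _ (fun n => L n phi0) c (c / 2)%R K1 K2).
- lra.
- by move=> n; exact: integral_ge0.
- by move=> n; exact: integral_ge0.
- by move=> n; exact: likelihood_phi0_gt0.
- by move=> n; rewrite -splitE; exact: fin.
- by move=> n; exact: num.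
- by move=> n; rewrite -splitE; exact: den.
Qed.
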